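(* Let $\Omega$ be the metric graph, with all edges of the same thickness, consisting of two vertices $\mathrm P_1,\mathrm P_2$, one edge $\mathrm P_1\mathrm P_2$ of finite length joining them, two outer paths $\Omega_1,\Omega_5$ of infinite length emanating from $\mathrm P_1$, and three outer paths $\Omega_2,\Omega_3,\Omega_4$ of infinite length emanating from $\mathrm P_2$. Assume that $$F(1)+(2^2-1)F(a)>0>F(1)+(3^2-1)F(a).$$ If the length of the edge $\mathrm P_1\mathrm P_2$ is sufficiently large, then $$\mathcal P(1,5)=1,\qquad\mathcal P(1,j)=0\quad(j=2,3,4).$$
   Context: At a vertex $V$ with incident edges $E_1,\ldots,E_m$, $\frac{\partial u}{\partial\nu_k}(V)$ denotes the derivative of $u$ at $V$ along $E_k$ (identified with an interval $[0,L]$ or $[0,\infty)$) in the direction pointing from $V$ into the interior of $E_k$; since all edges have the same thickness, the Kirchhoff condition at $V$ is $\sum_{k=1}^m\frac{\partial u}{\partial\nu_k}(V)=0$. Each outer path $\Omega_i$ has coordinate $x_i\in[0,\infty)$ with $x_i=0$ at the vertex from which it emanates. Nonlinearity: $f\in C^1$ and for some $0<a<1$: $f(0)=f(a)=f(1)=0$, $f<0$ on $(0,a)$, $f>0$ on $(a,1)$, $f'(0)<0$, $f'(a)>0$, $f'(1)<0$, $\int_0^1f(s)\,ds>0$. $F(s)=\int_0^sf(r)\,dr$. Solution of $\partial_tu=\Delta_\Omega u+f(u)$ on a time interval: a function $u(t,x)$ continuous in $(t,x)$ that satisfies $\partial_tu=\partial_x^2u+f(u)$ on each edge except at endpoints,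 with $\partial_xu$ continuous on each edge up to the endpoints, and the Kirchhoff condition at every vertex. Traveling wave: $(\phi,c)$, $c>0$, is the unique pair with $\phi''+c\phi'+f(\phi)=0$ and $0<\phi<1$ on $\mathbb R$, $\phi(-\infty)=1$, $\phi(+\infty)=0$, $\phi(0)=a$. Front-like solution and limit profile: for each $i$ there is a unique entire solution $\widehat u_i$ (defined for all $t\in\mathbb R$) with $0<\widehat u_i<1$ and $\lim_{t\to-\infty}\big(\sup_{x_i\in\Omega_i}|\widehat u_i|_{\Omega_i}(t,x_i)-\phi(-x_i-ct)|+\sup_{\Omega\setminus\Omega_i}|\widehat u_i(t,\cdot)|\big)=0$; it is strictly increasing in $t$. The limit profile is $\widehat v_i(x)=\lim_{t\to\infty}\widehat u_i(t,x)$. Propagation index: for $i\ne j$, $\lim_{x_j\to\infty}\widehat v_i|_{\Omega_j}(x_j)$ exists and equals $1$ or $0$; $\mathcal P(i,j)$ is this value ($1$: propagation from $\Omega_i$ to $\Omega_j$; $0$: blocking). *)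

(* Defs.v *)
From HB Require Import structures.
From mathcomp Require Import all_boot all_order all_algebra.
From mathcomp Require Import all_classical all_reals all_analysis.

Set Implicit Arguments.
Unset Strict Implicit.
Unset Printing Implicit Defensive.

Import Order.TTheory GRing.Theory Num.Theory.
Import numFieldNormedType.Exports.

Local Open Scope classical_set_scope.
Local Open Scope ring_scope.

(* A metric graph with vertices V, edges of finite length I and outer paths J,
   all of the same thickness.  The edge i is identified with [0, len i], where
   0 is the vertex src i and len i the vertex tgt i; the outer path j is
   identified with [0, +oo[, where 0 is the vertex base j. *)
Record metric_graph (R : realType) (V I J : finType) := MetricGraph {
  len : I -> {posnum R};
  src : I -> V;
  tgt : I -> V;
  base : J -> V }.

Definition edge_dom (R : realType) (V I J : finType)
    (G : metric_graph R V I J) (e : I + J) : set R :=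
  match e with
  | inl i => [set x | 0 <= x <= (len G i)%:num]
  | inr _ => [set x | 0 <= x]
  end.

Definition edge_interior (R : realType) (V I J : finType)
    (G : metric_graph R V I J) (e : I + J) : set R :=
  match e with
  | inl i => [set x | 0 < x < (len G i)%:num]
  | inr _ => [set x | 0 < x]
  end.

(* A function on the graph is given by its expression in the coordinate of
   each edge; only the values at the points of edge_dom G e are meaningful. *)
Definition graph_fun (R : realType) (I J : finType) := (I + J)%type -> R -> R.

(* Derivative relative to a set D: the usual derivative at interior points of
   D, and the one-sided derivative at an endpoint of an interval D. *)
Definition diff_quotient (R : realType) (g : R -> R) (x y : R) : R :=
  (g y - g x) / (y - x).

Definition derivable_on (R : realType) (D : set R) (g : R -> R) (x : R) : Prop :=
  cvg (diff_quotient g x y @[y --> within D x^']).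

Definition derive_on (R : realType) (D : set R) (g : R -> R) (x : R) : R :=
  lim (diff_quotient g x y @[y --> within D x^']).

Definition partial_x (R : realType) (V I J : finType)
    (G : metric_graph R V I J) (w : graph_fun R I J) : graph_fun R I J :=
  fun e => derive_on (edge_dom G e) (w e).

Definition single_valued_at_vertices (R : realType) (V I J : finType)
    (G : metric_graph R V I J) (w : graph_fun R I J) : Prop :=
  exists wV : V -> R,
    [/\ forall i, w (inl i) 0 = wV (src G i),
        forall i, w (inl i) (len G i)%:num = wV (tgt G i) &
        forall j, w (inr j) 0 = wV (base G j)].

(* Derivatives are taken from the vertex into the edge, whence the sign at the
   endpoint of coordinate len i. *)
Definition kirchhoff (R : realType) (V I J : finType)
    (G : metric_graph R V I J) (w : graph_fun R I J) (P : V) : Prop :=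
  \sum_(i | src G i == P) partial_x G w (inl i) 0
  - \sum_(i | tgt G i == P) partial_x G w (inl i) (len G i)%:num
  + \sum_(j | base G j == P) partial_x G w (inr j) 0 = 0.

Record entire_solution (R : realType) (V I J : finType)
    (G : metric_graph R V I J) (f : R -> R) (u : R -> graph_fun R I J) : Prop :=
  EntireSolution {
  sol_continuous : forall e,
    {within setT `*` edge_dom G e,
      continuous (fun p : R * R => u p.1 e p.2)};
  sol_vertices : forall t, single_valued_at_vertices G (u t);
  sol_derivable_x : forall t e x, edge_dom G e x ->
    derivable_on (edge_dom G e) (u t e) x;
  sol_continuous_x : forall t e,
    {within edge_dom G e, continuous (partial_x G (u t) e)};
  sol_derivable_t : forall t e x, edge_interior G e x ->
    derivable (fun s => u s e x) t 1;
  sol_derivable_xx : forall t e x, edge_interior G e x ->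
    derivable (partial_x G (u t) e) x 1;
  sol_equation : forall t e x, edge_interior G e x ->
    derive1 (fun s => u s e x) t = derive1 (partial_x G (u t) e) x + f (u t e x);
  sol_kirchhoff : forall t P, kirchhoff G (u t) P }.

(* The primitive of f vanishing at 0; meaningful for 0 <= s only. *)
Definition primitive (R : realType) (f : R -> R) (s : R) : R :=
  \int[lebesgue_measure]_(r in `[0, s]) f r.

Record bistable (R : realType) (f : R -> R) (a : R) : Prop := Bistable {
  bistable_a : 0 < a < 1;
  bistable_derivable : forall s, derivable f s 1;
  bistable_C1 : continuous (derive1 f);
  bistable_zeros : [/\ f 0 = 0, f a = 0 & f 1 = 0];
  bistable_neg : forall s, 0 < s < a -> f s < 0;
  bistable_pos : forall s, a < s < 1 -> 0 < f s;
  bistable_slopes : [/\ derive1 f 0 < 0, 0 < derive1 f a & derive1 f 1 < 0];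
  bistable_mass : 0 < primitive f 1 }.

Record traveling_wave (R : realType) (f : R -> R) (a : R)
    (phi : R -> R) (c : R) : Prop := TravelingWave {
  tw_speed : 0 < c;
  tw_derivable : forall z, derivable phi z 1;
  tw_derivable2 : forall z, derivable (derive1 phi) z 1;
  tw_equation : forall z, derive1 (derive1 phi) z + c * derive1 phi z + f (phi z) = 0;
  tw_range : forall z, 0 < phi z < 1;
  tw_left : phi z @[z --> -oo] --> (1 : R);
  tw_right : phi z @[z --> +oo] --> (0 : R);
  tw_normalization : phi 0 = a }.

(* The sets whose suprema are taken are bounded since u and phi take values in
   ]0, 1[; sup set0 = 0. *)
Record front_like_solution (R : realType) (V I J : finType)
    (G : metric_graph R V I J) (f phi : R -> R) (c : R) (i : J)
    (u : R -> graph_fun R I J) : Prop := FrontLikeSolution {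
  front_solution : entire_solution G f u;
  front_range : forall t e x, edge_dom G e x -> 0 < u t e x < 1;
  front_limit :
    (sup [set `|u t (inr i) x - phi (- x - c * t)|
           | x in edge_dom G (inr i)]
     + sup [set y | exists e x, [/\ e != inr i, edge_dom G e x &
                                    y = `|u t e x|]])
      @[t --> -oo] --> (0 : R) }.

Definition limit_profile (R : realType) (V I J : finType)
    (G : metric_graph R V I J) (u : R -> graph_fun R I J)
    (v : graph_fun R I J) : Prop :=
  forall e x, edge_dom G e x -> u t e x @[t --> +oo] --> v e x.

(* P(i, j) = p, where v is the limit profile of the front-like solution
   coming from the outer path i. *)
Definition propagation_index (R : realType) (I J : finType)
    (v : graph_fun R I J) (j : J) (p : R) : Prop :=
  v (inr j) x @[x --> +oo] --> p.

Definition Omega1 : 'I_5 := @Ordinal 5 0 isT.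
Definition Omega2 : 'I_5 := @Ordinal 5 1 isT.
Definition Omega3 : 'I_5 := @Ordinal 5 2 isT.
Definition Omega4 : 'I_5 := @Ordinal 5 3 isT.
Definition Omega5 : 'I_5 := @Ordinal 5 4 isT.

Definition P1 : 'I_2 := @Ordinal 2 0 isT.
Definition P2 : 'I_2 := @Ordinal 2 1 isT.

Definition two_vertex_graph (R : realType) (L : {posnum R}) :
    metric_graph R 'I_2 unit 'I_5 :=
  MetricGraph (fun=> L) (fun=> P1) (fun=> P2)
    (fun j => if j \in [:: Omega1; Omega5] then P1 else P2).

(* Main.v *)
Require Import Defs.
From HB Require Import structures.
From mathcomp Require Import all_boot all_order all_algebra.
From mathcomp Require Import all_classical all_reals all_analysis.
From mathcomp Require Import ring lra.

Set Implicit Arguments.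
Unset Strict Implicit.
Unset Printing Implicit Defensive.

Import Order.TTheory GRing.Theory Num.Theory.
Import numFieldNormedType.Exports.

Local Open Scope classical_set_scope.
Local Open Scope ring_scope.

(** Both halves of the statement are comparison arguments for the front-like
solution [u]; the bounds on [u] at large times pass to the limit profile [v].

The tool is the maximum principle [maximum_principle] on a metric graph.  It is
stated for a function [z] on which only second-order upper bounds are required
(jets), so that it applies to the difference of [u] and a function glued from
pieces of class C^2.  Its two specializations [subsolution_below] and
[supersolution_above] compare an entire solution with a function [w] which
satisfies w_t <= w_xx + f(w), resp. w_t >= w_xx + f(w), together with the
corresponding inequality for the sum of the outward derivatives at the vertices.
All profiles below come from the first-order equation w' = - g(w), where
g^2 / 2 + F is a prescribed energy ([energy_profile_exists]).

Blocking ([blocking]).  A time-independent supersolution: a constant not below 1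
on the paths 1 and 5; on the edge, the solution of w'' + f(w) = 0 whose energy is
slightly above F(1), which descends from 1 to [a] within a finite length and is
placed so that it ends at the second vertex (a long edge leaves room for it);
on the paths 2, 3 and 4, a profile which descends from [a] to an arbitrarily
small s > 0.  At the second vertex the slope on the edge is about
sqrt (2 (F(1) - F(a))), and each of the three outgoing slopes is about
sqrt (- 2 F(a)); the sum of the outward derivatives has the right sign because
F(1) + (3^2 - 1) F(a) < 0.  For very negative times [u] is below s away from the
path 1, hence below the supersolution at all later times, and s -> 0 gives the
limit 0.

Propagation ([fronts_cross_junction]).  A moving subsolution made of two fronts,
i.e. of profiles with a plateau which descend to 0 and satisfy
w'' + f(w) >= delta > 0, so that they remain subsolutions when they are
translated slowly.  A front Q with a plateau close to 1 comes in along the path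
1.  A front P with a plateau [theta], where F(theta) is positive and small,
leaves along the path 5 and along the edge, and comes to rest on the edge before
it reaches the second vertex (again a long edge is needed).  The positions are
matched so that the two fronts agree at the first vertex.  The vertex inequality
says that Q is at least twice as steep as P at equal values alpha; since the
squares of the slopes are about 2 (F(1) - F(alpha)) and - 2 F(alpha), it follows
from F(1) + (2^2 - 1) F(alpha) >= F(1) + (2^2 - 1) F(a) > 0.  Therefore
u >= theta eventually on every bounded part of the path 5.  As f > 0 on
(theta, 1), a slowly rising parabola then lifts this bound to any value below 1
far from the vertex ([growth]). *)

(** * Derivatives and second-order jets *)

Section Calculus.
Variable R : realType.
Implicit Types (g h w : R -> R) (x y z p q : R).

(** Derivatives relative to an edge are limits of difference quotients; this
is the bridge to the usual derivative. *)
Lemma is_derive_quotient g x l :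
  is_derive x 1 g l <-> diff_quotient g x y @[y --> x^'] --> l.
Proof.
split=> [/is_derive1_caratheodory[k [gE /continuous_withinNx kx <-]]|gl].
  apply: cvg_trans kx; apply: near_eq_cvg; near=> y.
  rewrite /diff_quotient gE mulfK// subr_eq0.
  by near: y; exact: nbhs_dnbhs_neq.
apply/is_derive1_caratheodory.
exists (fun y => if y == x then l else diff_quotient g x y); split.
- move=> z; case: eqP => [->|/eqP zx]; first by rewrite !subrr mulr0.
  by rewrite /diff_quotient divfK// subr_eq0.
- apply/continuous_withinNx; rewrite eqxx; apply: cvg_trans gl.
  apply: near_eq_cvg; near=> y; rewrite ifN//.
  by near: y; exact: nbhs_dnbhs_neq.
- by rewrite eqxx.
Unshelve. all: by end_near. Qed.

Lemma mean_value g g1 x y : x <= y ->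
  (forall z, x <= z <= y -> is_derive z 1 g (g1 z)) ->
  exists2 c, x <= c <= y & g y - g x = g1 c * (y - x).
Proof.
move=> xy dg.
have [||c cxy ->] := @MVT_segment R g g1 x y xy.
- by move=> z /[!in_itv]/= /andP[xz zy]; apply: dg; rewrite !ltW.
- apply: derivable_within_continuous => z /[!in_itv]/= /dg dgz.
  exact: ex_derive.
- by exists c => //; move: cxy; rewrite in_itv.
Qed.

(** Second-order upper bound at [x].  It is weaker than twice
differentiability, hence it survives gluing, and it is all that the second
derivative test at a minimum needs. *)
Definition upper_jet g x p q := forall e, 0 < e -> \forall y \near x,
  g y <= g x + p * (y - x) + (q + e) / 2 * (y - x) ^+ 2.

Definition lower_jet g x p q := forall e, 0 < e -> \forall y \near x,
  g x + p * (y - x) + (q - e) / 2 * (y - x) ^+ 2 <= g y.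

Lemma lower_jet_near g h x p q :
  (\forall y \near x, g y = h y) -> lower_jet g x p q -> lower_jet h x p q.
Proof.
move=> gh jg e e0; near=> y.
rewrite -(near gh y)// -(nbhs_singleton gh).
by near: y; exact: jg.
Unshelve. all: by end_near. Qed.

Lemma upper_jetN g x p q : lower_jet g x p q -> upper_jet (\- g) x (- p) (- q).
Proof.
move=> jg e e0; near=> y.
have : g x + p * (y - x) + (q - e) / 2 * (y - x) ^+ 2 <= g y.
  by near: y; exact: jg.
by rewrite /=; lra.
Unshelve. all: by end_near. Qed.

Lemma lower_jetN g x p q : upper_jet g x p q -> lower_jet (\- g) x (- p) (- q).
Proof.
move=> jg e e0; near=> y.
have : g y <= g x + p * (y - x) + (q + e) / 2 * (y - x) ^+ 2.
  by near: y; exact: jg.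
by rewrite /=; lra.
Unshelve. all: by end_near. Qed.

Lemma upper_jetD g h x p q p' q' : upper_jet g x p q -> upper_jet h x p' q' ->
  upper_jet (g \+ h) x (p + p') (q + q').
Proof.
move=> jg jh e e0; have e20 : 0 < e / 2 by rewrite divr_gt0.
near=> y.
have : g y <= g x + p * (y - x) + (q + e / 2) / 2 * (y - x) ^+ 2.
  by near: y; exact: jg.
have : h y <= h x + p' * (y - x) + (q' + e / 2) / 2 * (y - x) ^+ 2.
  by near: y; exact: jh.
by rewrite /=; nra.
Unshelve. all: by end_near. Qed.

Lemma upper_jetZ k g x p q : 0 < k -> upper_jet g x p q ->
  upper_jet (fun y => k * g y) x (k * p) (k * q).
Proof.
move=> k0 jg e e0; have ek0 : 0 < e / k by rewrite divr_gt0.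
near=> y.
have : g y <= g x + p * (y - x) + (q + e / k) / 2 * (y - x) ^+ 2.
  by near: y; exact: jg.
rewrite -(ler_pM2l k0) => /le_trans; apply; rewrite le_eqVlt; apply/orP; left.
by apply/eqP; field; rewrite gt_eqF.
Unshelve. all: by end_near. Qed.

Lemma lower_jet_le g x p q q' : q' <= q -> lower_jet g x p q ->
  lower_jet g x p q'.
Proof.
move=> qq jg e e0; near=> y.
have : g x + p * (y - x) + (q - e) / 2 * (y - x) ^+ 2 <= g y.
  by near: y; exact: jg.
apply: le_trans; rewrite lerD2l ler_wpM2r ?sqr_ge0//; lra.
Unshelve. all: by end_near. Qed.

(** The sum of the two bounds at x + s and x - s cancels the first-order term.
*)
Lemma upper_jet_min g x p q : (\forall y \near x, g x <= g y) ->
  upper_jet g x p q -> 0 <= q.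
Proof.
move=> gx jg; rewrite leNgt; apply/negP => q0.
have e0 : 0 < - q / 2 by lra.
have := filterI gx (jg _ e0); move=> [r /= r0 H].
pose s := r / 2.
have s0 : 0 < s by rewrite /s divr_gt0.
have sr : s < r by rewrite /s; lra.
have [|h1 h2] := H (x + s).
  by rewrite /= opprD addNKr normrN gtr0_norm.
have [|h3 h4] := H (x - s).
  by rewrite /= opprB addrC subrK gtr0_norm.
have s20 := exprn_gt0 2 s0.
have E1 : x + s - x = s by ring.
have E2 : x - s - x = - s by ring.
move: h2 h4; rewrite /= E1 E2 sqrrN => h2 h4.
nra.
Qed.

(** By the mean value theorem for the difference of [g] and the quadratic on
the right-hand side, whose derivative has the sign of x - y. *)
Lemma upper_jet_taylor g g1 x q :
  (\forall y \near x, is_derive (y : R) 1 g (g1 y)) -> is_derive x 1 g1 q ->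
  upper_jet g x (g1 x) q.
Proof.
move=> dg /is_derive1_caratheodory[k [g1E kx <-]] e e0.
have {}kx : \forall y \near x, `|k x - k y| < e by move/cvgrPdist_lt: kx; apply.
have [r /= r0 H] := filterI dg kx.
exists r => // y; rewrite /= => yxr.
pose D z := g z - (g x + g1 x * (z - x) + (k x + e) / 2 * (z - x) ^+ 2).
pose D1 z := g1 z - (g1 x + (k x + e) * (z - x)).
have dD z : `|x - z| < r -> is_derive z 1 D (D1 z).
  move=> /H[dgz _]; rewrite /D /D1.
  by have ? := dgz; apply: is_derive_eq; rewrite /GRing.scale /=; field.
have D0 : D x = 0 by rewrite /D subrr; ring.
have D1x : D1 x = 0 by rewrite /D1 subrr; ring.
have D1D z : `|x - z| < r -> D1 z * (z - x) <= 0.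
  move=> /H[_ kz]; rewrite /D1.
  have -> : g1 z = g1 x + k z * (z - x) by rewrite -g1E; ring.
  have -> : (g1 x + k z * (z - x) - (g1 x + (k x + e) * (z - x))) * (z - x) =
    - ((k x - k z + e) * (z - x) ^+ 2) by ring.
  rewrite oppr_le0 mulr_ge0 ?sqr_ge0//.
  by move: kz; rewrite ltr_norml => /andP[? ?]; lra.
suff : D y <= 0 by rewrite /D; lra.
have [xy|yx] := leP x y.
  have [z /andP[xz zy]|c /andP[xc cy]] := @mean_value D D1 x y xy.
    by apply: dD; move: yxr; rewrite !ltr_norml => /andP[? ?]; lra.
  rewrite D0 subr0 => ->; have [->|cx] := eqVneq c x; first by rewrite D1x mul0r.
  have : D1 c * (c - x) <= 0.
    by apply: D1D; move: yxr; rewrite !ltr_norml => /andP[? ?]; lra.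
  have {cx}xc : x < c by rewrite lt_neqAle eq_sym cx.
  rewrite pmulr_lle0 ?subr_gt0// => D1c.
  by rewrite mulr_le0_ge0// subr_ge0.
have [z /andP[xz zy]|c /andP[xc cy]] := @mean_value D D1 y x (ltW yx).
  by apply: dD; move: yxr; rewrite !ltr_norml => /andP[? ?]; lra.
rewrite D0 sub0r => E; have [cx|cx] := eqVneq c x.
  by move: E; rewrite cx D1x mul0r; lra.
have : D1 c * (c - x) <= 0.
  by apply: D1D; move: yxr; rewrite !ltr_norml => /andP[? ?]; lra.
have {cx}xc' : c < x by rewrite lt_neqAle cx.
rewrite nmulr_lle0 ?subr_lt0// => D1c.
by rewrite -oppr_ge0 E mulr_ge0// subr_ge0 ltW.
Qed.

End Calculus.
Lemma is_derive_translate (R : realType) (g : R -> R) (d x l : R) :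
  is_derive (x + d) 1 g l -> is_derive x 1 (fun y => g (y + d)) l.
Proof.
move=> dg.
have ? : is_derive x 1 (fun y => y + d) 1 by apply: is_derive_eq; rewrite addr0.
by rewrite -[l]mulr1; apply: (@is_derive1_comp _ g).
Qed.

Lemma antitone_derive (R : realType) (g g1 : R -> R) (x y : R) :
  (forall z : R, is_derive z 1 g (g1 z)) -> (forall z, g1 z <= 0) ->
  x <= y -> g y <= g x.
Proof.
move=> dg g1_le0 xy; have [c _ E] := mean_value xy (fun z _ => dg z).
by rewrite -subr_le0 E mulr_le0_ge0 ?subr_ge0.
Qed.

Lemma sqr_inj_pos (R : realDomainType) (x y : R) :
  0 < x -> 0 < y -> x ^+ 2 = y ^+ 2 -> x = y.
Proof. by move=> x0 y0 /eqP; rewrite eqrXn2 ?ltW// => /eqP. Qed.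

Lemma upper_jet_le (R : realType) (g : R -> R) x p q q' : q <= q' ->
  upper_jet g x p q -> upper_jet g x p q'.
Proof.
move=> qq jg e e0; near=> y.
have : g y <= g x + p * (y - x) + (q + e) / 2 * (y - x) ^+ 2.
  by near: y; exact: jg.
move/le_trans; apply; rewrite lerD2l ler_wpM2r ?sqr_ge0//; lra.
Unshelve. all: by end_near. Qed.

Lemma lower_jet_taylor (R : realType) (g g1 : R -> R) x q :
  (\forall y \near x, is_derive (y : R) 1 g (g1 y)) -> is_derive x 1 g1 q ->
  lower_jet g x (g1 x) q.
Proof.
move=> dg dg1.
have -> : g = \- (\- g) by apply/funext => y /=; rewrite opprK.
rewrite -[g1 x]opprK -[q]opprK; apply: lower_jetN.
apply: (@upper_jet_taylor _ (\- g) (\- g1)).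
by apply: filterS dg => y dy; exact: (is_deriveN dy).
Qed.

Section JetChange.
Variable R : realType.
Implicit Types (g : R -> R) (x p q d : R).

Lemma near_translate (A : set R) x d :
  (\forall z \near (x + d), A z) -> \forall y \near x, A (y + d).
Proof.
move=> H; have : (y + d) @[y --> x] --> x + d.
  by apply: cvgD; [exact: cvg_id|exact: cvg_cst].
exact.
Qed.

Lemma near_reflect (A : set R) x d :
  (\forall z \near (- x + d), A z) -> \forall y \near x, A (- y + d).
Proof.
move=> H; have : (- y + d) @[y --> x] --> - x + d.
  by apply: cvgD; [apply: cvgN; exact: cvg_id|exact: cvg_cst].
exact.
Qed.

Lemma lower_jet_translate g x d p q : lower_jet g (x + d) p q ->
  lower_jet (fun y => g (y + d)) x p q.
Proof.
move=> jg e /jg /near_translate; apply: filterS => y.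
by have -> : y + d - (x + d) = y - x by ring.
Qed.

Lemma lower_jet_reflect g x d p q : lower_jet g (- x + d) p q ->
  lower_jet (fun y => g (- y + d)) x (- p) q.
Proof.
move=> jg e /jg /near_reflect; apply: filterS => y.
have -> : - y + d - (- x + d) = - (y - x) by ring.
by rewrite sqrrN mulrN mulNr.
Qed.

Lemma is_derive_reflect g d x l :
  is_derive (- x + d) 1 g l -> is_derive x 1 (fun y => g (- y + d)) (- l).
Proof.
move=> dg.
have ? : is_derive x 1 (fun y => - y + d) (- 1) by apply: is_derive_eq; rewrite addr0.
by rewrite -[l]mulr1 -mulrN; apply: (@is_derive1_comp _ g).
Qed.

Lemma left_quotient_translate g (t d l : R) :
  diff_quotient g (t + d) s @[s --> (t + d)^'-] --> l ->
  diff_quotient (fun s => g (s + d)) t s @[s --> t^'-] --> l.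
Proof.
move=> /cvgrPdist_lt gl; apply/cvgrPdist_lt => e e0.
have := gl e e0; rewrite !near_withinE => /near_translate.
apply: filterS => s H st; have := H; rewrite ltrD2r => /(_ st).
by rewrite /diff_quotient (_ : s + d - (t + d) = s - t); last by ring.
Qed.

End JetChange.

(** * Autonomous equations and profiles of given energy *)

Section Antiderivatives.
Variable R : realType.
Implicit Types (g h w : R -> R) (x y z : R).

(** When the integrand vanishes on the negative half-line, the integral from
-1 to y is an antiderivative also at negative y, where the fundamental theorem
of calculus with a fixed lower bound does not apply. *)
Lemma antiderivative_pos h : continuous h -> (forall y, y <= 0 -> h y = 0) ->
  exists H, forall y, is_derive y 1 H (h y).
Proof.
move=> ch h0.
exists (fun y => \int[lebesgue_measure]_(t in `[-1, y]) h t) => y.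
have [y0|y0] := ltP y 0.
  rewrite h0 ?ltW//; apply: (@near_eq_is_derive _ _ _ (cst 0)).
  near=> z; rewrite /cst.
  transitivity (\int[lebesgue_measure]_(t in `[-1, z]) (0 : R)).
    by rewrite Rintegral_cst ?mul0r.
  apply: eq_Rintegral => t; rewrite inE/= in_itv/= => /andP[_ tz].
  apply/esym/h0.
  rewrite (le_trans tz)// ltW//; near: z.
  exact: lt_nbhsl.
have [] := @continuous_FTC1_closed R h (-1) y (y + 1).
- by rewrite ltrDl.
- apply: continuous_compact_integrable => //; first exact: segment_compact.
  exact: continuous_subspaceT.
- by rewrite (lt_le_trans _ y0)// ltrN10.
- exact: ch.
- by move=> d1; rewrite derive1E => <-; exact: DeriveDef.
Unshelve. all: by end_near. Qed.

(** [h] - [h] 0 is the sum of a function which vanishes on the left of 0 and a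
function which vanishes on the right of 0. *)
Lemma antiderivative h : continuous h ->
  exists H, forall y, is_derive y 1 H (h y).
Proof.
move=> ch.
have [|y y0|H1 dH1] := @antiderivative_pos (fun y => h (Num.max y 0) - h 0).
- move=> x; apply: cvgB; last exact: cvg_cst.
  apply: continuous_comp; last exact: ch.
  by apply: (@continuous_max _ _ id (cst 0)); [exact: cvg_id|exact: cvg_cst].
- by rewrite max_r// subrr.
have [|y y0|H2 dH2] := @antiderivative_pos (fun y => h (Num.min (- y) 0) - h 0).
- move=> x; apply: cvgB; last exact: cvg_cst.
  apply: continuous_comp; last exact: ch.
  apply: (@continuous_min _ _ -%R (cst 0)); last exact: cvg_cst.
  exact: opp_continuous.
- by rewrite min_r ?subrr// oppr_ge0.
exists (fun y => H1 y - (H2 \o -%R) y + y * h 0) => y.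
have := dH1 y; have := dH2 (- y) => dy2 dy1.
apply: is_derive_eq; rewrite /GRing.scale/= opprK.
by have [yle0|ylt0] := leP y 0; lra.
Qed.

Lemma derive_continuous g g1 : (forall x, is_derive x 1 g (g1 x)) ->
  continuous g.
Proof.
move=> dg x; apply/differentiable_continuous/derivable1_diffP.
by have := dg x; case.
Qed.

Lemma primitiveE g G s : continuous g -> (forall x, is_derive x 1 G (g x)) ->
  0 < s -> primitive g s = G s - G 0.
Proof.
move=> cg dG s0; rewrite /primitive /Rintegral.
have cG := derive_continuous dG.
rewrite (@continuous_FTC2 _ g G)//.
- exact: continuous_subspaceT.
- split.
  + by move=> x _; have := dG x; case.
  + exact/cvg_at_right_filter/cG.
  + exact/cvg_at_left_filter/cG.
- by move=> x _; rewrite derive1E; have := dG x => ?; exact: derive_val.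
Qed.

(** The solution is the inverse of H, an antiderivative of - 1 / g.  The
bounds on [g] make H a bijection of the line. *)
Lemma autonomous_flow g (m M y0 : R) : continuous g -> 0 < m ->
  (forall y, m <= g y <= M) ->
  exists w H : R -> R, [/\ w 0 = y0, cancel H w,
    forall x, is_derive x 1 w (- g (w x)) &
    forall y, is_derive y 1 H (- (g y)^-1)].
Proof.
move=> cg m0 gmM.
have g0 y : 0 < g y by have /andP[my _] := gmM y; exact: lt_le_trans my.
have M0 : 0 < M by have /andP[_] := gmM 0; exact: lt_le_trans.
have [|H0 dH0] := @antiderivative (fun y => - (g y)^-1).
  by move=> y; apply: cvgN; apply: cvgV; [rewrite gt_eqF|exact: cg].
pose H y := H0 y - H0 y0.
have dH y : is_derive y 1 H (- (g y)^-1).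
  by have ? := dH0 y; apply: is_derive_eq; rewrite subr0.
have Hlip x y : x <= y -> (y - x) / M <= H x - H y.
  move=> xy; have [c _ E] := mean_value xy (fun z _ => dH z).
  have -> : H x - H y = (y - x) * (g c)^-1 by rewrite -[LHS]opprB E; ring.
  rewrite ler_wpM2l ?subr_ge0//.
  by rewrite lef_pV2 ?posrE//; have /andP[] := gmM c.
have cH := derive_continuous dH.
have Hsurj x : exists y, H y == x.
  have [y] : exists2 y, y \in `[y0 - M * `|x|, y0 + M * `|x|] & H y = x.
    have x0 := normr_ge0 x.
    have Mx : 0 <= M * `|x| by rewrite mulr_ge0// ltW.
    apply: IVT; first by lra.
      exact: continuous_subspaceT.
    have H00 : H y0 = 0 by rewrite /H subrr.
    have h1 : _ := @Hlip (y0 - M * `|x|) y0 _.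
    have h2 : _ := @Hlip y0 (y0 + M * `|x|) _.
    move: (h1 ltac:(lra)) (h2 ltac:(lra)) => {}h1 {}h2.
    move: h1 h2; rewrite H00 subr0 sub0r opprB addrC subrK addrAC subrr add0r.
    rewrite mulrC mulKf ?gt_eqF// => h1 h2.
    rewrite ge_min le_max; apply/andP; split; apply/orP; [right|left].
      by have := ler_norm (- x); rewrite normrN; lra.
    by have := ler_norm x; lra.
  by move=> _ <-; exists y.
have [w wP] := choice Hsurj.
have wK : cancel w H by move=> x; apply/eqP.
have HK : cancel H w.
  move=> y; have E := wK (H y).
  apply/eqP; rewrite eq_le !leNgt; apply/andP; split; apply/negP => yw.
    have := Hlip _ _ (ltW yw); rewrite E subrr leNgt.
    by rewrite divr_gt0// subr_gt0.
  have := Hlip _ _ (ltW yw); rewrite E subrr leNgt.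
  by rewrite divr_gt0// subr_gt0.
exists w, H; split => //; first by rewrite -(HK y0) /H subrr.
move=> x; rewrite -{1}(wK x) -[- g _]invrK.
apply: is_derive_inverse.
- by near=> y; exact: HK.
- by near=> y; exact: cH.
- by rewrite invrN; exact: dH.
- by rewrite invrN oppr_eq0 invr_neq0// gt_eqF.
Unshelve. all: by end_near. Qed.

End Antiderivatives.

Section Quadrature.
Variable R : realType.
Implicit Types (g h w : R -> R) (x y z p q : R).

(** [w] solves w'' = - h (w) with energy w'^2 / 2 + H (w) = C as long as its
values are in [lo, hi], and it decreases on the whole line with slopes between
- M and - m; [W] is its inverse. *)
Record energy_profile (h H : R -> R) (C lo hi : R) (w W g : R -> R) (m M : R)
  : Prop := EnergyProfile {
  ep_m : 0 < m;
  ep_slope : forall y, m <= g y <= M;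
  ep_start : w 0 = hi;
  ep_WK : cancel W w;
  ep_dw : forall x, is_derive x 1 w (- g (w x));
  ep_dW : forall y, is_derive y 1 W (- (g y)^-1);
  ep_energy : forall y, lo <= y <= hi -> g y ^+ 2 = 2 * (C - H y);
  ep_ddw : forall x, lo <= w x <= hi ->
    is_derive x 1 (fun z => - g (w z)) (- h (w x)) }.

(** The slope is sqrt (2 (C - H)), with C - H truncated between two positive
constants so that it is defined on the whole line; the truncation is inactive
near [lo, hi]. *)
Lemma energy_profile_exists (h H : R -> R) (C lo hi : R) :
  (forall y, is_derive y 1 H (h y)) -> lo < hi ->
  (forall y, lo <= y <= hi -> H y < C) ->
  exists w W g m M, energy_profile h H C lo hi w W g m M.
Proof.
move=> dH lohi HC.
have cH := derive_continuous dH.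
have [c1 c1i Hmax] := EVT_max (ltW lohi) (continuous_subspaceT (A := `[lo, hi]) cH).
have [c2 c2i Hmin] := EVT_min (ltW lohi) (continuous_subspaceT (A := `[lo, hi]) cH).
pose m0 := (C - H c1) / 2; pose M0 := C - H c2 + 1.
have Hc1 : H c1 < C by apply: HC; move: c1i; rewrite in_itv.
have m00 : 0 < m0 by rewrite /m0; lra.
have m0M0 : m0 <= M0 by rewrite /m0 /M0; have := Hmax _ c2i; lra.
pose E y := Num.max m0 (Num.min M0 (C - H y)).
have Em y : m0 <= E y <= M0 by rewrite /E le_max lexx/= ge_max m0M0 ge_min lexx.
have cCH : continuous (fun y => C - H y).
  by move=> y; apply: cvgB; [exact: cvg_cst|exact: cH].
have cE : continuous E.
  move=> y; apply: (@continuous_max _ _ (cst m0) (fun y => Num.min M0 (C - H y))); first exact: cvg_cst.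
  by apply: (@continuous_min _ _ (cst M0) (fun y => C - H y)); [exact: cvg_cst|exact: cCH].
have Enear y : lo <= y <= hi -> \forall z \near y, C - H z = E z.
  move=> yi; have yi' : y \in `[lo, hi] by rewrite in_itv.
  have h1 : m0 < C - H y by rewrite /m0; have := Hmax _ yi'; lra.
  have h2 : C - H y < M0 by rewrite /M0; have := Hmin _ yi'; lra.
  near=> z.
  have k1 : m0 < C - H z.
    by near: z; apply: (cvgr_gt (C - H y)) => //; exact: cCH.
  have k2 : C - H z < M0.
    by near: z; apply: (cvgr_lt (C - H y)) => //; exact: cCH.
  by rewrite /E (min_r (ltW k2)) (max_r (ltW k1)).
pose g y := Num.sqrt (2 * E y).
have cg : continuous g.
  move=> y; apply: continuous_comp; last exact: sqrt_continuous.
  by apply: cvgM; [exact: cvg_cst|exact: cE].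
have m'0 : 0 < Num.sqrt (2 * m0) by rewrite sqrtr_gt0 mulr_gt0.
have gm y : Num.sqrt (2 * m0) <= g y <= Num.sqrt (2 * M0).
  have /andP[h1 h2] := Em y.
  by rewrite !ler_wsqrtr// ler_pM2l.
have [w [W [w0 WK dw dW]]] := autonomous_flow hi cg m'0 gm.
have g0 y : 0 < g y by have /andP[+ _] := gm y; exact: lt_le_trans.
have gE y : lo <= y <= hi -> g y ^+ 2 = 2 * (C - H y).
  move=> yi; rewrite /g sqr_sqrtr; first by rewrite -(nbhs_singleton (Enear _ yi)).
  by rewrite mulr_ge0// ltW// (lt_le_trans m00)//; have /andP[] := Em y.
have dg y : lo <= y <= hi -> is_derive y 1 g (- h y / g y).
  move=> yi; apply: (@near_eq_is_derive _ _ _ (Num.sqrt \o (fun z => 2 * (C - H z)))).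
    by near=> z; rewrite /g /= (near (Enear _ yi) z).
  have dHy := dH y.
  have p0 : 0 < 2 * (C - H y) by have := HC y yi; lra.
  have -> : - h y / g y = (2 * Num.sqrt (2 * (C - H y)))^-1 * (2 * (0 - h y)).
    rewrite /g -(nbhs_singleton (Enear _ yi)) invfM.
    by rewrite sub0r; field; rewrite gt_eqF// sqrtr_gt0.
  by apply: is_derive1_comp; exact: is_derive1_sqrt.
exists w, W, g, (Num.sqrt (2 * m0)), (Num.sqrt (2 * M0)); split => // x xi.
have dgx := dg _ xi; have dwx := dw x.
have dc : is_derive x 1 (g \o w) (- h (w x) / g (w x) * (- g (w x))).
  exact: is_derive1_comp.
have -> : - h (w x) = - (- h (w x) / g (w x) * (- g (w x))).
  by field; rewrite gt_eqF.
exact: is_deriveN.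
Unshelve. all: by end_near. Qed.

End Quadrature.

(** * Gluing profiles *)

Section Gluing.
Variable R : realType.
Implicit Types (A B g : R -> R) (c x y z : R).

Definition glue c A B z := if z <= c then A z else B z.

Lemma glue_left c A B z : z <= c -> glue c A B z = A z.
Proof. by rewrite /glue => ->. Qed.

Lemma glue_right c A B z : A c = B c -> c <= z -> glue c A B z = B z.
Proof.
rewrite /glue => AB; rewrite le_eqVlt => /predU1P[<-|cz]; first by rewrite lexx.
by rewrite leNgt cz.
Qed.

Lemma glue_near_left c A B z : z < c -> \forall y \near z, A y = glue c A B y.
Proof.
move=> zc; near=> y; rewrite glue_left// ltW//; near: y.
exact: lt_nbhsl.
Unshelve. all: by end_near. Qed.

Lemma glue_near_right c A B z : A c = B c -> c < z ->
  \forall y \near z, B y = glue c A B y.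
Proof.
move=> AB cz; near=> y; rewrite glue_right// ltW//; near: y.
exact: lt_nbhsr.
Unshelve. all: by end_near. Qed.

(** The difference quotient at the junction is one of the two difference
quotients on each side. *)
Lemma glue_derive c A B (p : R -> R) : A c = B c ->
  (forall z, z <= c -> is_derive z 1 A (p z)) ->
  (forall z, c <= z -> is_derive z 1 B (p z)) ->
  forall z, is_derive z 1 (glue c A B) (p z).
Proof.
move=> AB dA dB z; have [zc|cz|->] := ltgtP z c.
- apply: near_eq_is_derive; first exact: glue_near_left.
  by apply: dA; rewrite ltW.
- apply: near_eq_is_derive; first exact: glue_near_right.
  by apply: dB; rewrite ltW.
- apply/is_derive_quotient/cvgrPdist_lt => e e0.
  have qA : \forall y \near c^', `|p c - diff_quotient A c y| < e.
    by move: e e0; apply/cvgrPdist_lt/is_derive_quotient/dA.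
  have qB : \forall y \near c^', `|p c - diff_quotient B c y| < e.
    by move: e e0 {qA}; apply/cvgrPdist_lt/is_derive_quotient/dB.
  near=> y.
  have : `|p c - diff_quotient A c y| < e by near: y.
  have : `|p c - diff_quotient B c y| < e by near: y.
  rewrite /diff_quotient [glue c A B c]glue_left//.
  have [yc|/ltW cy] := leP y c; first by rewrite glue_left.
  by rewrite AB glue_right.
Unshelve. all: by end_near. Qed.

Lemma glue_lower_jet c A B z p q : A c = B c ->
  (z <= c -> lower_jet A z p q) -> (c <= z -> lower_jet B z p q) ->
  lower_jet (glue c A B) z p q.
Proof.
move=> AB jA jB; have [zc|cz|zc] := ltgtP z c.
- apply: lower_jet_near; first exact: glue_near_left.
  by apply: jA; rewrite ltW.
- apply: lower_jet_near; first exact: glue_near_right.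
  by apply: jB; rewrite ltW.
- move: jA jB; rewrite zc => /(_ (lexx c)) jA /(_ (lexx c)) jB e e0.
  near=> y; rewrite [glue c A B c]glue_left//.
  have [yc|/ltW cy] := leP y c.
    by rewrite glue_left//; near: y; exact: jA.
  by rewrite glue_right// AB; near: y; exact: jB.
Unshelve. all: by end_near. Qed.

Lemma glue_upper_jet c A B z p q : A c = B c ->
  (z <= c -> upper_jet A z p q) -> (c <= z -> upper_jet B z p q) ->
  upper_jet (glue c A B) z p q.
Proof.
move=> AB jA jB.
have -> : glue c A B = \- glue c (\- A) (\- B).
  by apply/funext => y; rewrite /glue/=; case: ifP => _; rewrite opprK.
rewrite -[p]opprK -[q]opprK; apply: upper_jetN; apply: glue_lower_jet.
- by rewrite /= AB.
- by move=> /jA; exact: lower_jetN.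
- by move=> /jB; exact: lower_jetN.
Qed.

End Gluing.

(** * The maximum principle on a metric graph *)

Section RelativeDerivative.
Variable R : realType.
Implicit Types (D : set R) (g h : R -> R) (x l : R).

Lemma derive_on_cvg D g x l : ProperFilter (within D x^') ->
  diff_quotient g x y @[y --> within D x^'] --> l ->
  derivable_on D g x /\ derive_on D g x = l.
Proof.
move=> PF gl; split; first by apply/cvg_ex; exists l.
exact: (cvg_lim (@Rhausdorff R)).
Qed.

Lemma is_derive_within D g x l : is_derive x 1 g l ->
  diff_quotient g x y @[y --> within D x^'] --> l.
Proof. by move=> /is_derive_quotient gl; apply: cvg_within_filter. Qed.

Lemma diff_quotientD g h x : diff_quotient (g \+ h) x =
  diff_quotient g x \+ diff_quotient h x.
Proof. by apply/funext => y; rewrite /diff_quotient /= opprD addrACA mulrDl. Qed.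

Lemma diff_quotientN g x : diff_quotient (\- g) x = \- diff_quotient g x.
Proof. by apply/funext => y; rewrite /diff_quotient /= -opprD mulNr. Qed.

(** Used at the vertices, where the weight has a nonzero slope [k]. *)
Lemma derive_on_left_min D g h x k : ProperFilter (within D x^') ->
  derivable_on D g x -> is_derive x 1 h k ->
  (forall y, D y -> x <= y) -> (forall y, D y -> g x + h x <= g y + h y) ->
  0 <= derive_on D g x + k.
Proof.
move=> PF dg dh Dx gh.
have /cvgD/(_ (is_derive_within D dh)) := dg.
rewrite -[X in X @ _ --> _]/(diff_quotient g x \+ diff_quotient h x).
rewrite -diff_quotientD => ghl.
apply: (cvgr_to_ge ghl); near=> y.
have Dy : D y by near: y; exact: withinT.
by rewrite /diff_quotient divr_ge0// subr_ge0 ?gh ?Dx.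
Unshelve. all: by end_near. Qed.

Lemma derive_on_right_min D g h x k : ProperFilter (within D x^') ->
  derivable_on D g x -> is_derive x 1 h k ->
  (forall y, D y -> y <= x) -> (forall y, D y -> g x + h x <= g y + h y) ->
  derive_on D g x + k <= 0.
Proof.
move=> PF dg dh Dx gh.
have /cvgD/(_ (is_derive_within D dh)) := dg.
rewrite -[X in X @ _ --> _]/(diff_quotient g x \+ diff_quotient h x).
rewrite -diff_quotientD => ghl.
apply: (cvgr_to_le ghl); near=> y.
have Dy : D y by near: y; exact: withinT.
by rewrite /diff_quotient mulr_ge0_le0// ?invr_le0 ?subr_ge0 ?subr_le0 ?gh ?Dx.
Unshelve. all: by end_near. Qed.

Variables (V I J : finType) (G : metric_graph R V I J).

Lemma edge_dom_proper (e : I + J) x : edge_dom G e x ->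
  ProperFilter (within (edge_dom G e) x^').
Proof.
move=> xe; apply: Build_ProperFilter_ex => P [r /= r0 rP].
case: e xe rP => [i|j] /= xe rP.
- have l0 : 0 < (len G i)%:num by [].
  set l := (len G i)%:num in xe rP l0.
  have [xl|lx] := ltP x (l / 2).
    pose s := Num.min (r / 2) (l / 2).
    have s0 : 0 < s by rewrite lt_min !divr_gt0.
    have sl : s <= l / 2 by rewrite ge_min lexx orbT.
    have sr : s <= r / 2 by rewrite ge_min lexx.
    exists (x + s); apply: rP.
    + by rewrite /= opprD addNKr normrN gtr0_norm//; lra.
    + by rewrite gt_eqF// ltrDl.
    + by rewrite /=; move/andP: xe => [? ?]; apply/andP; split; lra.
  pose s := Num.min (r / 2) (l / 2).
  have s0 : 0 < s by rewrite lt_min !divr_gt0.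
  have sl : s <= l / 2 by rewrite ge_min lexx orbT.
  have sr : s <= r / 2 by rewrite ge_min lexx.
  exists (x - s); apply: rP.
  + by rewrite /= opprB addrC subrK gtr0_norm//; lra.
  + by rewrite lt_eqF// gtrBl.
  + by rewrite /=; move/andP: xe => [? ?]; apply/andP; split; lra.
- exists (x + r / 2); apply: rP.
  + by rewrite /= opprD addNKr normrN gtr0_norm ?divr_gt0//; lra.
  + by rewrite gt_eqF// ltrDl divr_gt0.
  + by rewrite /= addr_ge0// divr_ge0// ltW.
Qed.

End RelativeDerivative.

Section Weight.
Variables (R : realType) (V I J : finType) (G : metric_graph R V I J).
Implicit Types (e : (I + J)%type) (x y t : R) (w : graph_fun R I J) (P : V).

Definition kirchhoff_sum w P : R :=
  \sum_(i | src G i == P) partial_x G w (inl i) 0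
  - \sum_(i | tgt G i == P) partial_x G w (inl i) (len G i)%:num
  + \sum_(j | base G j == P) partial_x G w (inr j) 0.

Definition negative_at w P := [/\
  forall i, src G i = P -> w (inl i) 0 < 0,
  forall i, tgt G i = P -> w (inl i) (len G i)%:num < 0 &
  forall j, base G j = P -> w (inr j) 0 < 0].

(** It tends to infinity along the outer paths and equals 2 at every vertex,
from which it decreases strictly into each edge: added to a function, it
excludes minima at infinity and at the vertices. *)
Definition weight e x : R :=
  match e with
  | inl i => 2 - 4 * x * ((len G i)%:num - x) / (len G i)%:num ^+ 2
  | inr _ => 1 + (x - 1) ^+ 2
  end.

Definition weight_slope e x : R :=
  match e with
  | inl i => (8 * x - 4 * (len G i)%:num) / (len G i)%:num ^+ 2
  | inr _ => 2 * (x - 1)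
  end.

Definition weight_curvature e : R :=
  match e with
  | inl i => 8 / (len G i)%:num ^+ 2
  | inr _ => 2
  end.

Lemma weight_ge1 e x : 1 <= weight e x.
Proof.
case: e => [i|j] /=; last by rewrite lerDl sqr_ge0.
have l0 : 0 < (len G i)%:num by [].
move: (len G i)%:num l0 => l l0.
rewrite lerBrDr -lerBrDl (_ : 2 - 1 = 1); last by ring.
rewrite ler_pdivrMr ?exprn_gt0// mul1r -subr_ge0.
have -> : l ^+ 2 - 4 * x * (l - x) = (l - 2 * x) ^+ 2 by ring.
exact: sqr_ge0.
Qed.

Lemma weight_taylor e x y : weight e y =
  weight e x + weight_slope e x * (y - x) + weight_curvature e / 2 * (y - x) ^+ 2.
Proof.
case: e => [i|j] /=; last by field.
by field; apply/negP => /eqP l0; have : 0 < (len G i)%:num by []; rewrite l0 ltxx.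
Qed.

Lemma weight_derive e x : is_derive x 1 (weight e) (weight_slope e x).
Proof.
apply/is_derive1_caratheodory.
exists (fun y => weight_slope e x + weight_curvature e / 2 * (y - x)); split.
- by move=> y; rewrite (weight_taylor e x y); ring.
- apply: cvgD; first exact: cvg_cst.
  by apply: cvgM; [exact: cvg_cst|apply: cvgB; [exact: cvg_id|exact: cvg_cst]].
- by rewrite subrr mulr0 addr0.
Qed.

Lemma weight_upper_jet e x : upper_jet (weight e) x (weight_slope e x) (weight_curvature e).
Proof.
move=> d d0; near=> y; rewrite (weight_taylor e x y).
by rewrite lerD2l ler_wpM2r ?sqr_ge0//; lra.
Unshelve. all: by end_near. Qed.

Definition weight_curvature_bound : R := 2 + \sum_i weight_curvature (inl i).

Lemma weight_curvature_le e : weight_curvature e <= weight_curvature_bound.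
Proof.
have p0 i : 0 <= weight_curvature (inl i) by rewrite /= divr_ge0// exprn_ge0.
rewrite /weight_curvature_bound; case: e => [i|j].
  by rewrite (bigD1 i)//= addrCA lerDl addr_ge0// sumr_ge0.
by rewrite lerDl sumr_ge0.
Qed.

Lemma weight_curvature_bound_gt0 : 0 < weight_curvature_bound.
Proof.
apply: ltr_pwDl => //; apply: sumr_ge0 => i _ /=.
by rewrite divr_ge0// exprn_ge0.
Qed.

Definition edge_end (X : R) e : R :=
  match e with inl i => (len G i)%:num | inr _ => X end.

(** The graph cut at distance X on the outer paths is compact. *)
Lemma truncated_minimum (Z : R -> graph_fun R I J) (t0 T X : R)
    (e1 : (I + J)%type) : t0 <= T -> 0 <= X ->
  (forall e, {within `[t0, T] `*` `[0, edge_end X e],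
     continuous (fun p : R * R => Z p.1 e p.2)}) ->
  exists t e x, [/\ t0 <= t <= T, 0 <= x <= edge_end X e &
    forall t' e' x', t0 <= t' <= T -> 0 <= x' <= edge_end X e' ->
      Z t e x <= Z t' e' x'].
Proof.
move=> t0T X0 cZ.
have end0 e : 0 <= edge_end X e by case: e => [i|j] /=.
have pick e : exists p : R * R,
    (t0 <= p.1 <= T /\ 0 <= p.2 <= edge_end X e) /\
    forall p', t0 <= p'.1 <= T /\ 0 <= p'.2 <= edge_end X e ->
      Z p.1 e p.2 <= Z p'.1 e p'.2.
  have [||p] := @compact_EVT_min _ _ _ (`[t0, T] `*` `[0, edge_end X e]) _ _ (cZ e).
  - by exists (t0, 0); split; rewrite /= in_itv/= lexx ?t0T ?end0.
  - by apply: compact_setX; exact: segment_compact.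
  - rewrite inE /= !in_itv /= => pin pmin; exists p; split => // p' p'in.
    by apply: pmin; rewrite inE /= !in_itv.
have {pick}[pk pkP] := choice pick.
have [e _ emin] := @arg_minP _ _ _ e1 xpredT
  (fun e => Z (pk e).1 e (pk e).2) isT.
have [[pt px] pmin] := pkP e.
exists (pk e).1, e, (pk e).2; split => // t' e' x' ht' hx'.
apply: (le_trans (emin e' isT)).
by have [_] := pkP e' => /(_ (t', x')); apply.
Qed.

End Weight.

Section MaximumPrinciple.
Variables (R : realType) (V I J : finType) (G : metric_graph R V I J).
Implicit Types (e : (I + J)%type) (x y t : R) (w : graph_fun R I J) (P : V).

Lemma left_quotientM (E g : R -> R) t E1 g1 : is_derive t 1 E E1 ->
  diff_quotient g t s @[s --> t^'-] --> g1 ->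
  diff_quotient (fun s => E s * g s) t s @[s --> t^'-] --> E t * g1 + E1 * g t.
Proof.
move=> dE dg.
have -> : diff_quotient (fun s => E s * g s) t =
    (fun s => E s * diff_quotient g t s + diff_quotient E t s * g t).
  by apply/funext => s; rewrite /diff_quotient; ring.
apply: cvgD.
  apply: cvgM dg; apply: cvg_at_left_filter.
  by apply/differentiable_continuous/derivable1_diffP; case: dE.
apply: cvgM; last exact: cvg_cst.
by apply: cvg_dnbhs_at_left; apply/is_derive_quotient.
Qed.

Lemma vertex_partial_pos w P :
  (forall i, src G i = P -> 0 < partial_x G w (inl i) 0) ->
  (forall i, tgt G i = P -> partial_x G w (inl i) (len G i)%:num < 0) ->
  (forall j, base G j = P -> 0 < partial_x G w (inr j) 0) ->
  (exists i, src G i = P) \/ (exists i, tgt G i = P) \/ (exists j, base G j = P) ->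
  0 < kirchhoff_sum G w P.
Proof.
move=> s0 t0 b0 H.
have S0 : 0 <= \sum_(i | src G i == P) partial_x G w (inl i) 0.
  by apply: sumr_ge0 => i /eqP /s0 /ltW.
have T0 : \sum_(i | tgt G i == P) partial_x G w (inl i) (len G i)%:num <= 0.
  by apply: sumr_le0 => i /eqP /t0 /ltW.
have B0 : 0 <= \sum_(j | base G j == P) partial_x G w (inr j) 0.
  by apply: sumr_ge0 => j /eqP /b0 /ltW.
rewrite /kirchhoff_sum; case: H => [[i iP]|[[i iP]|[j jP]]].
- have : 0 < \sum_(i | src G i == P) partial_x G w (inl i) 0.
    rewrite (bigD1 i) ?iP//= ltr_pwDl ?s0//.
    by apply: sumr_ge0 => k /andP[/eqP /s0 /ltW].
  by lra.
- have : \sum_(i | tgt G i == P) partial_x G w (inl i) (len G i)%:num < 0.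
    rewrite (bigD1 i) ?iP//= ltr_nwDl ?t0//.
    by apply: sumr_le0 => k /andP[/eqP /t0 /ltW].
  by lra.
- have : 0 < \sum_(j | base G j == P) partial_x G w (inr j) 0.
    rewrite (bigD1 j) ?jP//= ltr_pwDl ?b0//.
    by apply: sumr_ge0 => k /andP[/eqP /b0 /ltW].
  by lra.
Qed.

(** If z is negative somewhere, exp (- M (t - t0)) z + eta r, where r is the
weight and eta is small, has a negative minimum.  It is not attained at the
initial time.  At an interior point of an edge the time derivative is
nonpositive and the second derivative is nonnegative, which contradicts the
differential inequality because M exceeds K by the bound on r''.  At a vertex
all outward derivatives of z are positive, because those of r are negative,
which contradicts the inequality there. *)
Theorem maximum_principle (z : R -> graph_fun R I J) (t0 T K B : R) :
  0 <= K ->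
  (forall e, {within `[t0, T] `*` edge_dom G e,
     continuous (fun p : R * R => z p.1 e p.2)}) ->
  (forall t, t0 <= t <= T -> single_valued_at_vertices G (z t)) ->
  (forall t e x, t0 <= t <= T -> edge_dom G e x -> - B <= z t e x) ->
  (forall e x, edge_dom G e x -> 0 <= z t0 e x) ->
  (forall t e x, t0 < t <= T -> edge_interior G e x -> z t e x < 0 ->
     exists zt p q, [/\ diff_quotient (fun s => z s e x) t s @[s --> t^'-] --> zt,
       upper_jet (z t e) x p q & q + K * z t e x <= zt]) ->
  (forall t e x, t0 < t <= T -> edge_dom G e x ->
     derivable_on (edge_dom G e) (z t e) x) ->
  (forall t P, t0 < t <= T -> negative_at G (z t) P ->
     kirchhoff_sum G (z t) P <= 0) ->
  forall t e x, t0 <= t <= T -> edge_dom G e x -> 0 <= z t e x.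
Proof.
move=> K0 zcont zsv zB z0 zint zder zkir t1 e1 x1 t1i x1e1.
rewrite leNgt; apply/negP => z1.
have t0T : t0 <= T by case/andP: t1i; exact: le_trans.
(* M - K bounds the second derivative of the weight, hence also its ratio to
   the weight, which is at least 1. *)
pose M := K + weight_curvature_bound G.
have M0 : 0 < M by rewrite ltr_wpDl// weight_curvature_bound_gt0.
pose E t := expR (- M * (t - t0)).
have E0 t : 0 < E t by exact: expR_gt0.
have E1 t : t0 <= t -> E t <= 1.
  by move=> t0t; rewrite expR_le1 mulNr oppr_le0 mulr_ge0 ?subr_ge0// ltW.
have dE t : is_derive t 1 E (- M * E t).
  apply: is_derive_eq; rewrite /GRing.scale /=; rewrite /E; ring.
(* This value of eta makes Z half of exp (- M (t1 - t0)) z at the given point.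
   *)
pose eta := - (E t1 * z t1 e1 x1) / (2 * weight G e1 x1).
have w0 e x : 0 < weight G e x by exact: lt_le_trans (weight_ge1 _ _ _).
have eta0 : 0 < eta.
  by rewrite /eta divr_gt0 ?mulr_gt0// oppr_gt0 pmulr_rlt0.
pose Z t e x := E t * z t e x + eta * weight G e x.
have Z1 : Z t1 e1 x1 < 0.
  have -> : Z t1 e1 x1 = E t1 * z t1 e1 x1 / 2.
    by rewrite /Z /eta; field; rewrite gt_eqF.
  by rewrite pmulr_llt0// pmulr_rlt0.
have B0 : 0 <= B by have := zB _ _ _ t1i x1e1; lra.
have EzB t e x : t0 <= t <= T -> edge_dom G e x -> - B <= E t * z t e x.
  move=> ti xe; have := zB _ _ _ ti xe; case/andP: ti => /E1 Et1 _ zBx.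
  have := E0 t; nra.
(* Beyond X on the outer paths, eta times the weight exceeds the bound B. *)
pose X := 2 + B / eta.
have X0 : 0 <= X by rewrite addr_ge0// divr_ge0// ltW.
have Zfar t e x : t0 <= t <= T -> edge_dom G e x -> edge_end G X e < x ->
    0 < Z t e x.
  move=> ti; case: e => [i|j] /= xe Xx; first by move/andP: xe => [_]; rewrite leNgt Xx.
  have h1 := EzB _ (inr j) _ ti xe; rewrite /Z /=.
  have : B < eta * (1 + (x - 1) ^+ 2).
    rewrite -ltr_pdivrMl//; have : B / eta + 2 < x by rewrite addrC.
    have : 0 <= B / eta by rewrite divr_ge0// ltW.
    by rewrite mulrC; nra.
  by lra.
have edge_sub e x : 0 <= x <= edge_end G X e -> edge_dom G e x.
  by case: e => [i|j] //= /andP[].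
have cZ e : {within `[t0, T] `*` `[0, edge_end G X e],
    continuous (fun p : R * R => Z p.1 e p.2)}.
  have cz : {within `[t0, T] `*` `[0, edge_end G X e],
      continuous (fun p : R * R => z p.1 e p.2)}.
    apply: continuous_subspaceW (zcont e) => p [p1 p2]; split => //.
    by apply: edge_sub; move: p2; rewrite /= in_itv.
  move=> p; apply: cvgD.
    apply: cvgM; last exact: cz.
    apply: (@continuous_subspaceT _ _ _ (fun p : R * R => E p.1)) => q.
    apply: (@continuous_comp _ _ _ fst E); first exact: cvg_fst.
    apply/differentiable_continuous/derivable1_diffP.
    by have := dE q.1; case.
  apply: cvgM; first exact: cvg_cst.
  apply: (@continuous_subspaceT _ _ _ (fun p : R * R => weight G e p.2)) => q.
  apply: (@continuous_comp _ _ _ snd (weight G e)); first exact: cvg_snd.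
  apply/differentiable_continuous/derivable1_diffP.
  by have := weight_derive G e q.2; case.
have [t [e [x [ti xe Zmin]]]] := truncated_minimum e1 t0T X0 cZ.
have {}Zmin t' e' x' : t0 <= t' <= T -> edge_dom G e' x' -> Z t e x <= Z t' e' x'.
  have Ztex : Z t e x < 0.
    apply: le_lt_trans (Z1); apply: Zmin => //.
    apply/andP; split; first by case: (e1) x1e1 => [i|j] //= /andP[].
    rewrite leNgt; apply/negP => /(Zfar _ _ _ t1i x1e1).
    by rewrite ltNge (ltW Z1).
  move=> t'i xe'; have [x'X|Xx'] := leP x' (edge_end G X e').
    apply: Zmin => //; apply/andP; split => //.
    by case: (e') xe' => [i|j] //= /andP[].
  by apply: ltW (lt_trans Ztex _); exact: Zfar.
have Zneg : Z t e x < 0 by apply: le_lt_trans (Z1); exact: Zmin.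
have {}xe := edge_sub _ _ xe.
have zlt : E t * z t e x < - eta * weight G e x by move: Zneg; rewrite /Z; lra.
have zneg : z t e x < 0.
  rewrite -(pmulr_rlt0 _ (E0 t)); apply: (lt_trans zlt).
  by rewrite mulNr oppr_lt0 mulr_gt0.
have t0t : t0 < t.
  rewrite lt_neqAle; case/andP: (ti) => -> _; rewrite andbT.
  by apply/eqP => tt; move: zneg; rewrite -tt ltNge z0.
have ti' : t0 < t <= T by rewrite t0t; case/andP: ti.
have [xint|xend] := pselect (edge_interior G e x).
  have [zt [p [q [dzt jz qzt]]]] := zint _ _ _ ti' xint zneg.
  have : 0 <= E t * q + eta * weight_curvature G e.
    apply: (@upper_jet_min _ (Z t e) x (E t * p + eta * weight_slope G e x)).
      have : \forall y \near x, edge_dom G e y.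
        case: (e) xint => [i|j] /=.
          move=> /andP[x0 xl]; near=> y; apply/andP; split; apply: ltW.
            by near: y; exact: lt_nbhsr.
          by near: y; exact: lt_nbhsl.
        by move=> x0; near=> y; apply: ltW; near: y; exact: lt_nbhsr.
      by apply: filterS => y; exact: Zmin.
    apply: upper_jetD; apply: upper_jetZ => //.
    exact: weight_upper_jet.
  have : E t * zt + (- M * E t) * z t e x <= 0.
    have dEz := left_quotientM (dE t) dzt.
    apply: (cvgr_to_le dEz); near=> s.
    have st : s < t by near: s; exact: nbhs_left_lt.
    have t0s : t0 < s by near: s; exact: nbhs_left_gt.
    rewrite /diff_quotient mulr_ge0_le0 ?invr_le0 ?subr_le0 ?(ltW st)// subr_ge0.
    have := Zmin s e x; rewrite /Z lerD2r; apply => //.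
    by rewrite ltW//= (le_trans (ltW st))//; case/andP: ti.
  have Eqz : E t * q + K * (E t * z t e x) <= E t * zt.
    by rewrite -[K * _]mulrCA -mulrDr ler_pM2l.
  have W0 := weight_curvature_bound_gt0 G; have We := weight_curvature_le G e.
  have wx1 := weight_ge1 G e x.
  move=> Ezt Eq0.
  have h1 : weight_curvature_bound G * (E t * z t e x) < weight_curvature_bound G * (- eta * weight G e x).
    by rewrite ltr_pM2l.
  have h2 : eta * weight_curvature G e <= eta * weight_curvature_bound G by rewrite ler_pM2l.
  have h3 : eta * weight_curvature_bound G <= eta * weight_curvature_bound G * weight G e x.
    by rewrite ler_peMr// mulr_ge0// ltW.
  have h4 : M * E t * z t e x = K * (E t * z t e x) + weight_curvature_bound G * (E t * z t e x).
    by rewrite /M; ring.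
  by lra.
(* At a vertex z is single valued and the weight is 2 on every incident edge,
   so that the minimum is attained on all of them. *)
have we0 e' x' : edge_dom G e' x' -> ~ edge_interior G e' x' -> weight G e' x' = 2.
  case: e' => [i|j] /= h1 h2.
    have l0 : 0 < (len G i)%:num by [].
    have [->|x'0] := eqVneq x' 0; first by rewrite mulr0 !mul0r subr0.
    have -> : x' = (len G i)%:num.
      apply/eqP; rewrite eq_le; case/andP: h1 => x'0' -> /=.
      rewrite leNgt; apply/negP => x'l; apply: h2; rewrite x'l andbT.
      by rewrite lt_neqAle eq_sym x'0.
    by rewrite subrr mulr0 mul0r subr0.
  have -> : x' = 0.
    by apply/eqP; rewrite eq_le h1 andbT leNgt; apply/negP.
  by ring.
have [wV [wsrc wtgt wbase]] := zsv t ti.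
have [P [wP incP]] : exists P, wV P = z t e x /\
    ((exists i, src G i = P) \/ (exists i, tgt G i = P) \/
     (exists j, base G j = P)).
  move: xe xend; case: (e) => [i|j] /= h1 h2.
    have [->|x0] := eqVneq x 0.
      by exists (src G i); split; [rewrite wsrc|left; exists i].
    exists (tgt G i); split; last by right; left; exists i.
    rewrite -wtgt; congr (z t _ _).
    apply/eqP; rewrite eq_le; case/andP: h1 => x0' ->.
    rewrite andbT leNgt; apply/negP => x'l; apply: h2; rewrite x'l andbT.
    by rewrite lt_neqAle eq_sym x0.
  exists (base G j); split; last by right; right; exists j.
  rewrite -wbase; congr (z t _ _).
  by apply/eqP; rewrite eq_le h1 /= leNgt; apply/negP.
have wx2 : weight G e x = 2 by apply: we0.
pose k := eta / E t.
have k0 : 0 < k by rewrite divr_gt0.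
have Zk e' x' : z t e' x' + k * weight G e' x' = (E t)^-1 * Z t e' x'.
  by rewrite /Z /k; field; rewrite gt_eqF.
have minP e' x' : edge_dom G e' x' -> ~ edge_interior G e' x' ->
    z t e' x' = wV P -> forall y, edge_dom G e' y ->
    z t e' x' + k * weight G e' x' <= z t e' y + k * weight G e' y.
  move=> h1 h2 h3 y h4; rewrite h3 wP (we0 _ _ h1 h2) -wx2 !Zk.
  by rewrite ler_pM2l ?invr_gt0//; exact: Zmin.
have dk e' x' : is_derive x' 1 (fun y => k * weight G e' y) (k * weight_slope G e' x').
  by have ? := weight_derive G e' x'; apply: is_derive_eq.
suff : 0 < kirchhoff_sum G (z t) P.
  rewrite ltNge zkir//; split => [i iP|i iP|j jP].
  - by rewrite wsrc iP wP.
  - by rewrite wtgt iP wP.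
  - by rewrite wbase jP wP.
apply: vertex_partial_pos incP => [i iP|i iP|j jP].
- have l0 : 0 < (len G i)%:num by [].
  have d0 : edge_dom G (inl i) 0 by rewrite /= lexx ltW.
  have n0 : ~ edge_interior G (inl i) 0 by rewrite /= ltxx.
  have v0 : z t (inl i) 0 = wV P by rewrite wsrc iP.
  have := derive_on_left_min (edge_dom_proper d0) (zder _ _ _ ti' d0) (dk _ _)
    _ (minP _ _ d0 n0 v0).
  have : k * weight_slope G (inl i) 0 < 0.
    by rewrite pmulr_rlt0//= mulr0 sub0r pmulr_llt0 ?invr_gt0 ?exprn_gt0//; lra.
  rewrite /partial_x => h1 h2; have : 0 <= derive_on (edge_dom G (inl i)) (z t (inl i)) 0 + k * weight_slope G (inl i) 0.
    by apply: h2 => y /andP[].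
  by lra.
- have l0 : 0 < (len G i)%:num by [].
  have d0 : edge_dom G (inl i) (len G i)%:num by rewrite /= lexx ltW.
  have n0 : ~ edge_interior G (inl i) (len G i)%:num by rewrite /= ltxx andbF.
  have v0 : z t (inl i) (len G i)%:num = wV P by rewrite wtgt iP.
  have := derive_on_right_min (edge_dom_proper d0) (zder _ _ _ ti' d0) (dk _ _)
    _ (minP _ _ d0 n0 v0).
  have : 0 < k * weight_slope G (inl i) (len G i)%:num.
    by rewrite pmulr_rgt0//= pmulr_lgt0 ?invr_gt0 ?exprn_gt0//; lra.
  rewrite /partial_x => h1 h2; have : derive_on (edge_dom G (inl i)) (z t (inl i)) (len G i)%:num + k * weight_slope G (inl i) (len G i)%:num <= 0.
    by apply: h2 => y /andP[].
  by lra.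
- have d0 : edge_dom G (inr j) 0 by rewrite /= lexx.
  have n0 : ~ edge_interior G (inr j) 0 by rewrite /= ltxx.
  have v0 : z t (inr j) 0 = wV P by rewrite wbase jP.
  have := derive_on_left_min (edge_dom_proper d0) (zder _ _ _ ti' d0) (dk _ _)
    _ (minP _ _ d0 n0 v0).
  have : k * weight_slope G (inr j) 0 < 0 by rewrite pmulr_rlt0//=; lra.
  rewrite /partial_x => h1 h2; have : 0 <= derive_on (edge_dom G (inr j)) (z t (inr j)) 0 + k * weight_slope G (inr j) 0.
    by apply: h2 => y.
  by lra.
Unshelve. all: by end_near. Qed.

End MaximumPrinciple.

(** * Comparison of an entire solution with sub- and supersolutions *)

Section Comparison.
Variables (R : realType) (V I J : finType) (G : metric_graph R V I J).
Implicit Types (e : (I + J)%type) (x y t : R) (w : graph_fun R I J) (P : V).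

Lemma edge_interior_dom e x : edge_interior G e x -> edge_dom G e x.
Proof.
by case: e => [i|j] /=; [move=> /andP[/ltW -> /ltW ->]|exact: ltW].
Qed.

Lemma edge_interior_near e x : edge_interior G e x ->
  \forall y \near x, edge_interior G e y.
Proof.
case: e => [i|j] /=; last exact: lt_nbhsr.
move=> /andP[x0 xl]; near=> y; apply/andP; split; near: y.
  exact: lt_nbhsr.
exact: lt_nbhsl.
Unshelve. all: by end_near. Qed.

Lemma interior_is_derive e (g : R -> R) x : edge_interior G e x ->
  derivable_on (edge_dom G e) g x -> is_derive x 1 g (derive_on (edge_dom G e) g x).
Proof.
move=> xe /cvgrPdist_lt dg; apply/is_derive_quotient/cvgrPdist_lt => d d0.
have Dx : \forall y \near x^', edge_dom G e y.
  apply: nbhs_dnbhs; apply: filterS (edge_interior_near xe).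
  exact: edge_interior_dom.
have := dg d d0; rewrite near_withinE => dgd; near=> y.
by near: y; apply: filterS2 dgd Dx => y; exact.
Unshelve. all: by end_near. Qed.

Lemma derive_on_is_derive e (g : R -> R) x l : edge_dom G e x ->
  is_derive x 1 g l ->
  derivable_on (edge_dom G e) g x /\ derive_on (edge_dom G e) g x = l.
Proof.
move=> xe dg; have PF := edge_dom_proper xe.
by apply: derive_on_cvg; exact: is_derive_within.
Qed.

Lemma derive_onB e (g h : R -> R) x : edge_dom G e x ->
  derivable_on (edge_dom G e) g x -> derivable_on (edge_dom G e) h x ->
  derivable_on (edge_dom G e) (g \- h) x /\
  derive_on (edge_dom G e) (g \- h) x =
    derive_on (edge_dom G e) g x - derive_on (edge_dom G e) h x.
Proof.
move=> xe dg dh; have PF := edge_dom_proper xe; apply: derive_on_cvg.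
rewrite (diff_quotientD g (\- h)) diff_quotientN; exact: cvgB dg dh.
Qed.

Definition graph_derivable w :=
  forall e x, edge_dom G e x -> derivable_on (edge_dom G e) (w e) x.

Lemma edge_dom0 e : edge_dom G e 0.
Proof. by case: e => [i|j] /=; rewrite lexx// ltW. Qed.

Lemma edge_dom_len i : edge_dom G (inl i) (len G i)%:num.
Proof. by rewrite /= lexx ltW. Qed.

Lemma kirchhoff_sumB w w' P : graph_derivable w -> graph_derivable w' ->
  kirchhoff_sum G (fun e x => w e x - w' e x) P =
  kirchhoff_sum G w P - kirchhoff_sum G w' P.
Proof.
move=> dw dw'.
have E e x : edge_dom G e x -> partial_x G (fun e x => w e x - w' e x) e x =
    partial_x G w e x - partial_x G w' e x.
  by move=> xe; have [] := derive_onB xe (dw _ _ xe) (dw' _ _ xe).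
rewrite /kirchhoff_sum.
have Es i := E _ _ (edge_dom0 (inl i)); have Et i := E _ _ (edge_dom_len i).
have Eb j := E _ _ (edge_dom0 (inr j)).
rewrite (eq_bigr _ (fun i _ => Es i)) (eq_bigr _ (fun i _ => Et i)).
rewrite (eq_bigr _ (fun j _ => Eb j)).
by rewrite !sumrB; ring.
Qed.

Lemma single_valuedB w w' : single_valued_at_vertices G w ->
  single_valued_at_vertices G w' ->
  single_valued_at_vertices G (fun e x => w e x - w' e x).
Proof.
move=> [wV [s t b]] [wV' [s' t' b']]; exists (fun P => wV P - wV' P).
split => k /=; first by rewrite s s'.
  by rewrite t t'.
by rewrite b b'.
Qed.

Variables (f : R -> R) (u : R -> graph_fun R I J) (K : R).
Hypothesis K0 : 0 <= K.
Hypothesis fK : forall x y, 0 <= x <= 1 -> 0 <= y <= 1 ->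
  `|f x - f y| <= K * `|x - y|.
Hypothesis u_sol : entire_solution G f u.
Hypothesis u01 : forall t e x, edge_dom G e x -> 0 < u t e x < 1.

(** The spatial derivative of a solution is differentiable, so the solution
has Taylor expansions of order two inside the edges. *)
Lemma solution_jet t e x : edge_interior G e x ->
  exists ut p q, [/\ is_derive t 1 (fun s => u s e x) ut,
    upper_jet (u t e) x p q, lower_jet (u t e) x p q & ut = q + f (u t e x)].
Proof.
move=> xe.
exists (derive1 (fun s => u s e x) t), (partial_x G (u t) e x),
  (derive1 (partial_x G (u t) e) x).
have dp : is_derive x 1 (partial_x G (u t) e) (derive1 (partial_x G (u t) e) x).
  by rewrite derive1E; apply: derivableP; exact: (sol_derivable_xx u_sol).
have du : \forall y \near x, is_derive (y : R) 1 (u t e) (partial_x G (u t) e y).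
  apply: filterS (edge_interior_near xe) => y ye; apply: interior_is_derive => //.
  by apply: (sol_derivable_x u_sol); exact: edge_interior_dom.
split.
- by rewrite derive1E; apply: derivableP; exact: (sol_derivable_t u_sol).
- exact: upper_jet_taylor.
- exact: lower_jet_taylor.
- exact: (sol_equation u_sol).
Qed.

Lemma solution_continuous t0 T e : {within `[t0, T] `*` edge_dom G e,
  continuous (fun p : R * R => u p.1 e p.2)}.
Proof.
apply: continuous_subspaceW (@sol_continuous _ _ _ _ _ _ _ u_sol e) => p [_ p2].
by split.
Qed.

Lemma is_derive_left (g : R -> R) t l : is_derive t 1 g l ->
  diff_quotient g t s @[s --> t^'-] --> l.
Proof. by move=> /is_derive_quotient gl; exact: cvg_dnbhs_at_left. Qed.

(** With z = u - w, the Lipschitz constant K of f on [0, 1] bounds f(u) - f(w)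
from below by K z where z is negative. *)
Theorem subsolution_below (w : R -> graph_fun R I J) (t0 T : R) :
  (forall e, {within `[t0, T] `*` edge_dom G e,
     continuous (fun p : R * R => w p.1 e p.2)}) ->
  (forall t, t0 <= t <= T -> single_valued_at_vertices G (w t)) ->
  (forall t e x, t0 <= t <= T -> edge_dom G e x -> w t e x <= 1) ->
  (forall e x, edge_dom G e x -> w t0 e x <= u t0 e x) ->
  (forall t e x, t0 < t <= T -> edge_interior G e x -> u t e x < w t e x ->
     exists wt p q, [/\ diff_quotient (fun s => w s e x) t s @[s --> t^'-] --> wt,
       lower_jet (w t e) x p q & wt <= q + f (w t e x)]) ->
  (forall t, t0 < t <= T -> graph_derivable (w t)) ->
  (forall t P, t0 < t <= T ->
     negative_at G (fun e x => u t e x - w t e x) P ->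
     0 <= kirchhoff_sum G (w t) P) ->
  forall t e x, t0 <= t <= T -> edge_dom G e x -> w t e x <= u t e x.
Proof.
move=> wc wsv w1 w0 wint wder wkir t e x ti xe; rewrite -subr_ge0.
apply: (@maximum_principle R V I J G (fun t e x => u t e x - w t e x) t0 T K 1
  _ _ _ _ _ _ _ _ t e x) => //.
- by move=> d p; apply: cvgB; [exact: solution_continuous|exact: wc].
- by move=> s si; apply: single_valuedB; [exact: (sol_vertices u_sol)|exact: wsv].
- move=> s d y si yd; have := w1 _ _ _ si yd; have := u01 s yd; lra.
- by move=> d y yd; rewrite subr_ge0 w0.
- move=> s d y si yd zneg; have yd' := edge_interior_dom yd.
  have [ut [p [q [dut ju _ ute]]]] := solution_jet s yd.
  have [|wt [p' [q' [dwt jw wte]]]] := wint _ _ _ si yd; first by lra.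
  exists (ut - wt), (p + - p'), (q + - q'); split.
  + rewrite (diff_quotientD (fun s => u s d y) (\- (fun s => w s d y))).
    rewrite diff_quotientN.
    by apply: cvgB dwt; exact: is_derive_left.
  + by apply: upper_jetD => //; exact: upper_jetN.
  + have si' : t0 <= s <= T by case/andP: si => /ltW -> ->.
    have := w1 _ _ _ si' yd'; have /andP[u0 u1] := u01 s yd' => w1'.
    have : `|f (u s d y) - f (w s d y)| <= K * `|u s d y - w s d y|.
      by apply: fK; apply/andP; split; lra.
    rewrite (ltr0_norm zneg) ler_norml => /andP[h1 h2].
    by lra.
- move=> s d y si yd; have [] := @derive_onB d (u s d) (w s d) y yd => //.
    exact: (sol_derivable_x u_sol).
  exact: wder.
- move=> s P si neg; rewrite kirchhoff_sumB.
  + have := wkir _ _ si neg; have : kirchhoff_sum G (u s) P = 0.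
      exact: (sol_kirchhoff u_sol).
    by lra.
  + by move=> ? ? ?; exact: (sol_derivable_x u_sol).
  + exact: wder.
Qed.

Theorem supersolution_above (w : R -> graph_fun R I J) (t0 T : R) :
  (forall e, {within `[t0, T] `*` edge_dom G e,
     continuous (fun p : R * R => w p.1 e p.2)}) ->
  (forall t, t0 <= t <= T -> single_valued_at_vertices G (w t)) ->
  (forall t e x, t0 <= t <= T -> edge_dom G e x -> 0 <= w t e x) ->
  (forall e x, edge_dom G e x -> u t0 e x <= w t0 e x) ->
  (forall t e x, t0 < t <= T -> edge_interior G e x -> w t e x < u t e x ->
     exists wt p q, [/\ diff_quotient (fun s => w s e x) t s @[s --> t^'-] --> wt,
       upper_jet (w t e) x p q & q + f (w t e x) <= wt]) ->
  (forall t, t0 < t <= T -> graph_derivable (w t)) ->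
  (forall t P, t0 < t <= T ->
     negative_at G (fun e x => w t e x - u t e x) P ->
     kirchhoff_sum G (w t) P <= 0) ->
  forall t e x, t0 <= t <= T -> edge_dom G e x -> u t e x <= w t e x.
Proof.
move=> wc wsv w1 w0 wint wder wkir t e x ti xe; rewrite -subr_ge0.
apply: (@maximum_principle R V I J G (fun t e x => w t e x - u t e x) t0 T K 1
  _ _ _ _ _ _ _ _ t e x) => //.
- by move=> d p; apply: cvgB; [exact: wc|exact: solution_continuous].
- by move=> s si; apply: single_valuedB; [exact: wsv|exact: (sol_vertices u_sol)].
- move=> s d y si yd; have := w1 _ _ _ si yd; have := u01 s yd; lra.
- by move=> d y yd; rewrite subr_ge0 w0.
- move=> s d y si yd zneg; have yd' := edge_interior_dom yd.
  have [ut [p [q [dut _ ju ute]]]] := solution_jet s yd.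
  have [|wt [p' [q' [dwt jw wte]]]] := wint _ _ _ si yd; first by lra.
  exists (wt - ut), (p' + - p), (q' + - q); split.
  + rewrite (diff_quotientD (fun s => w s d y) (\- (fun s => u s d y))).
    rewrite diff_quotientN.
    by apply: (cvgB dwt); exact: is_derive_left.
  + by apply: upper_jetD => //; exact: upper_jetN.
  + have si' : t0 <= s <= T by case/andP: si => /ltW -> ->.
    have := w1 _ _ _ si' yd'; have /andP[u0 u1] := u01 s yd' => w1'.
    have : `|f (w s d y) - f (u s d y)| <= K * `|w s d y - u s d y|.
      by apply: fK; apply/andP; split; lra.
    rewrite (ltr0_norm zneg) ler_norml => /andP[h1 h2].
    by lra.
- move=> s d y si yd; have [] := @derive_onB d (w s d) (u s d) y yd => //.
    exact: wder.
  exact: (sol_derivable_x u_sol).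
- move=> s P si neg; rewrite kirchhoff_sumB.
  + have := wkir _ _ si neg; have : kirchhoff_sum G (u s) P = 0.
      exact: (sol_kirchhoff u_sol).
    by lra.
  + exact: wder.
  + by move=> ? ? ?; exact: (sol_derivable_x u_sol).
Qed.

End Comparison.

Lemma bistable_lipschitz (R : realType) (f : R -> R) (a : R) : bistable f a ->
  exists2 K, 0 <= K & forall x y, 0 <= x <= 1 -> 0 <= y <= 1 ->
  `|f x - f y| <= K * `|x - y|.
Proof.
move=> hf.
have cf : continuous (fun x => `|derive1 f x|).
  by move=> x; apply: cvg_norm; exact: (bistable_C1 hf).
have [c _ cmax] := @EVT_max R (fun x => `|derive1 f x|) 0 1 ler01
  (continuous_subspaceT cf).
exists `|derive1 f c| => // x y.
have df (z : R) : is_derive z 1 f (derive1 f z).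
  by rewrite derive1E; apply: derivableP; exact: (bistable_derivable hf).
wlog xy : x y / x <= y.
  move=> H x01 y01; have [xy|/ltW yx] := leP x y; first exact: H.
  by rewrite distrC [X in _ * X]distrC H.
move=> /andP[x0 x1] /andP[y0 y1].
have [d /andP[xd dy] E] := mean_value xy (fun z _ => df z).
rewrite distrC E normrM distrC ler_wpM2r//; apply: cmax.
by rewrite in_itv/=; apply/andP; split; lra.
Qed.

(** * The bistable potential *)

Section Potential.
Variables (R : realType) (f F : R -> R) (a : R).
Hypothesis hf : bistable f a.
Hypothesis dF : forall x : R, is_derive x 1 F (f x).
Hypothesis F0 : F 0 = 0.
Implicit Types (x y z b top : R).

Lemma bistable_continuous : continuous f.
Proof.
move=> x; apply/differentiable_continuous/derivable1_diffP.
exact: (bistable_derivable hf).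
Qed.

Lemma potential_nonincreasing x y : 0 <= x -> x <= y -> y <= a -> F y <= F x.
Proof.
move=> x0 xy ya; have [c /andP[xc cy] E] := mean_value xy (fun z _ => dF z).
rewrite -subr_le0 E mulr_le0_ge0 ?subr_ge0//.
have [f0 fa _] := bistable_zeros hf.
have [->|ca] := eqVneq c a; first by rewrite fa.
have [->|c0] := eqVneq c 0; first by rewrite f0.
apply: ltW; apply: (bistable_neg hf); rewrite !lt_neqAle ca eq_sym c0 /=.
by apply/andP; split; lra.
Qed.

Lemma potential_nondecreasing x y : a <= x -> x <= y -> y <= 1 -> F x <= F y.
Proof.
move=> ax xy y1; have [c /andP[xc cy] E] := mean_value xy (fun z _ => dF z).
rewrite -subr_ge0 E mulr_ge0 ?subr_ge0//.
have [_ fa f1] := bistable_zeros hf.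
have [->|ca] := eqVneq c a; first by rewrite fa.
have [->|c0] := eqVneq c 1; first by rewrite f1.
apply: ltW; apply: (bistable_pos hf); rewrite !lt_neqAle c0 eq_sym ca /=.
by apply/andP; split; lra.
Qed.

(** [F] decreases on [0, a] and increases on [a, 1]. *)
Lemma potential_ge_Fa x : 0 <= x <= 1 -> F a <= F x.
Proof.
move=> /andP[x0 x1]; have [xa|/ltW ax] := leP x a.
  exact: potential_nonincreasing.
exact: potential_nondecreasing.
Qed.

Lemma potential_le_top b y : a <= b <= 1 -> 0 <= F b -> 0 <= y <= b -> F y <= F b.
Proof.
move=> /andP[ab b1] Fb /andP[y0 yb]; have [ya|/ltW ay] := leP y a.
  by apply: le_trans Fb; rewrite -F0; exact: potential_nonincreasing.
exact: potential_nondecreasing.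
Qed.

End Potential.

(** The decay rate comes from f'(0) < 0; near 0 the potential is close to F 0
= 0. *)
Lemma bistable_decay (R : realType) (f F : R -> R) (a eta : R) :
  bistable f a -> (forall x : R, is_derive x 1 F (f x)) -> F 0 = 0 -> 0 < eta ->
  exists m s1, [/\ 0 < m, 0 < s1 < a, - eta <= F s1 &
    forall y, 0 <= y <= s1 -> f y <= - m * y].
Proof.
move=> hf dF F0 eta0; have /andP[a0 _] := bistable_a hf.
have [f0 _ _] := bistable_zeros hf; have [f'0 _ _] := bistable_slopes hf.
pose m := - derive1 f 0 / 2.
have m0 : 0 < m by rewrite /m; lra.
have df0 : is_derive (0 : R) 1 f (derive1 f 0).
  by rewrite derive1E; apply: derivableP; exact: (bistable_derivable hf).
have q0 : \forall y \near (0 : R)^', diff_quotient f 0 y < - m.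
  by apply: (cvgr_lt (derive1 f 0)); [exact/is_derive_quotient|rewrite /m; lra].
have F0near : \forall y \near (0 : R), - eta < F y.
  have cF : F y @[y --> (0 : R)] --> F 0 by exact: (derive_continuous dF).
  have F0eta : - eta < F 0 by rewrite F0; lra.
  exact: (cvgr_gt _ cF _ F0eta).
have [r1 /= r10 h1] := q0; have [r2 /= r20 h2] := F0near.
pose s1 := Num.min (a / 2) (Num.min (r1 / 2) (r2 / 2)).
have s10 : 0 < s1 by rewrite !lt_min !divr_gt0.
have s1a : s1 <= a / 2 by rewrite ge_min lexx.
have s1r1 : s1 <= r1 / 2 by rewrite !ge_min lexx orbT.
have s1r2 : s1 <= r2 / 2 by rewrite !ge_min lexx !orbT.
exists m, s1; split => //.
- by rewrite s10 /=; lra.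
- by apply/ltW/h2; rewrite /= sub0r normrN gtr0_norm//; lra.
- move=> y /andP[]; rewrite le_eqVlt => /predU1P[<- _|y0 ys1].
    by rewrite f0 mulr0.
  have := h1 y; rewrite /= sub0r normrN gtr0_norm// gt_eqF// => /(_ _ isT).
  rewrite /diff_quotient f0 !subr0 ltr_pdivrMr// => h.
  by apply/ltW/h; lra.
Qed.

(** * The graph with two vertices *)

Section TwoVertexGraph.
Variables (R : realType) (L : {posnum R}).
Notation G := (two_vertex_graph L).
Implicit Types (w : graph_fun R unit 'I_5) (P : 'I_2) (j : 'I_5).

Lemma outer_path_cases j :
  [\/ j = Omega1, j = Omega5 | [\/ j = Omega2, j = Omega3 | j = Omega4]].
Proof.
case: j => -[|[|[|[|[|k]]]]] //= lt.
- by apply: Or31; apply: val_inj.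
- by apply: Or33; apply: Or31; apply: val_inj.
- by apply: Or33; apply: Or32; apply: val_inj.
- by apply: Or33; apply: Or33; apply: val_inj.
- by apply: Or32; apply: val_inj.
Qed.

Lemma vertex_cases P : P = P1 \/ P = P2.
Proof.
by case: P => -[|[|k]] //= lt; [left|right]; apply: val_inj.
Qed.

Lemma big_outer (F : 'I_5 -> R) (p : pred 'I_5) : \sum_(j | p j) F j =
  (if p Omega1 then F Omega1 else 0) + (if p Omega2 then F Omega2 else 0) +
  (if p Omega3 then F Omega3 else 0) + (if p Omega4 then F Omega4 else 0) +
  (if p Omega5 then F Omega5 else 0).
Proof.
rewrite big_mkcond !big_ord_recl big_ord0 /= addr0 !addrA.
have E1 : ord0 = Omega1 by apply: val_inj.
have E2 : lift ord0 ord0 = Omega2 by apply: val_inj.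
have E3 : lift ord0 (lift ord0 ord0) = Omega3 by apply: val_inj.
have E4 : lift ord0 (lift ord0 (lift ord0 ord0)) = Omega4 by apply: val_inj.
have E5 : lift ord0 (lift ord0 (lift ord0 (lift ord0 ord0))) = Omega5.
  by apply: val_inj.
by rewrite E5 E4 E3 E2 E1.
Qed.

Lemma big_inner (F : unit -> R) (p : pred unit) :
  \sum_(i | p i) F i = if p tt then F tt else 0.
Proof.
case: ifP => pt; first by apply: big_pred1 => -[]; rewrite /= pt.
by apply: big_pred0 => -[].
Qed.

Lemma kirchhoff_sum_P1 w : kirchhoff_sum G w P1 =
  partial_x G w (inl tt) 0 + partial_x G w (inr Omega1) 0 +
  partial_x G w (inr Omega5) 0.
Proof. by rewrite /kirchhoff_sum !big_inner big_outer /=; ring. Qed.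

Lemma kirchhoff_sum_P2 w : kirchhoff_sum G w P2 =
  - partial_x G w (inl tt) L%:num + partial_x G w (inr Omega2) 0 +
  partial_x G w (inr Omega3) 0 + partial_x G w (inr Omega4) 0.
Proof. by rewrite /kirchhoff_sum !big_inner big_outer /=; ring. Qed.

Lemma negative_at_P1 w : negative_at G w P1 -> w (inr Omega1) 0 < 0.
Proof. by move=> [_ _]; apply. Qed.

Lemma negative_at_P2 w : negative_at G w P2 -> w (inr Omega2) 0 < 0.
Proof. by move=> [_ _]; apply. Qed.

Lemma single_valued_two_vertex w :
  w (inr Omega1) 0 = w (inl tt) 0 -> w (inr Omega5) 0 = w (inl tt) 0 ->
  w (inr Omega2) 0 = w (inl tt) L%:num -> w (inr Omega3) 0 = w (inl tt) L%:num ->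
  w (inr Omega4) 0 = w (inl tt) L%:num -> single_valued_at_vertices G w.
Proof.
move=> h1 h5 h2 h3 h4.
exists (fun P => if P == P1 then w (inl tt) 0 else w (inl tt) L%:num).
split=> [[]|[]|j] //.
by case: (outer_path_cases j) => [->|->|[->|->|->]].
Qed.

End TwoVertexGraph.

Section StaticFunctions.
Variables (R : realType) (V I J : finType) (G : metric_graph R V I J).

Lemma static_quotient (g : R) t :
  diff_quotient (fun _ : R => g) t s @[s --> t^'-] --> (0 : R).
Proof.
have -> : diff_quotient (fun _ : R => g) t = cst 0.
  by apply/funext => s; rewrite /diff_quotient subrr mul0r.
exact: cvg_cst.
Qed.

Lemma graph_derivable_of (w w1 : graph_fun R I J) :
  (forall e (x : R), is_derive x 1 (w e) (w1 e x)) -> graph_derivable G w.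
Proof. by move=> dw e x xe; have [] := derive_on_is_derive xe (dw e x). Qed.

Lemma partial_x_of (w w1 : graph_fun R I J) e (x : R) : edge_dom G e x ->
  (forall e (x : R), is_derive x 1 (w e) (w1 e x)) -> partial_x G w e x = w1 e x.
Proof. by move=> xe dw; have [] := derive_on_is_derive xe (dw e x). Qed.

End StaticFunctions.

(** * Blocking at the second vertex *)

Section Blocking.
Variables (R : realType) (f F : R -> R) (a : R).
Hypothesis hf : bistable f a.
Hypothesis dF : forall x : R, is_derive x 1 F (f x).
Hypothesis F0 : F 0 = 0.

(** A supersolution on the half-line which leaves [a] with a given slope and
tends to [s].  It stays above [s] > 0, so that a function which is uniformly
small is below it. *)
Record decaying_profile (slope s : R) (N n : R -> R) : Prop := DecayingProfile {
  dp_start : N 0 = a;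
  dp_slope : n 0 = slope;
  dp_derive : forall x : R, is_derive x 1 N (n x);
  dp_ge : forall x, 0 <= x -> s <= N x;
  dp_jet : forall x, 0 < x -> upper_jet N x (n x) (- f (N x));
  dp_small : forall e, 0 < e -> exists X, forall x, X <= x -> N x <= s + e }.

(** From [a] to s1 the profile is a solution of small energy; from s1 on it is
the exponential s + (s1 - s) exp (- ks (x - T)), a supersolution because f(y)
<= - m y near 0 and ks^2 <= m.  The rate ks depends on s so that the slope at
the junction, hence the slope at the start, does not. *)
Lemma decaying_profile_exists (eta : R) : 0 < eta ->
  exists slope s0, [/\ slope < 0, - 2 * F a - eta <= slope ^+ 2, 0 < s0 <= a &
    forall s, 0 < s < s0 -> exists N n, decaying_profile slope s N n].
Proof.
move=> eta0; have /andP[a0 a1] := bistable_a hf.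
have eta20 : 0 < eta / 2 by rewrite divr_gt0.
have [m [s1 [m0 /andP[s10 s1a] Fs1 fm]]] := bistable_decay hf dF F0 eta20.
(* ks <= 2 kap for s <= s1 / 2, so that ks^2 <= m. *)
pose kap := Num.sqrt m / 2.
have kap0 : 0 < kap by rewrite divr_gt0// sqrtr_gt0.
have kap2 : kap ^+ 2 = m / 4 by rewrite /kap expr_div_n sqr_sqrtr ?ltW//; field.
pose p := kap * s1.
have p0 : 0 < p by rewrite mulr_gt0.
pose C := F s1 + p ^+ 2 / 2.
have HC y : s1 <= y <= a -> F y < C.
  move=> /andP[h1 h2].
  have := potential_nonincreasing hf dF (ltW s10) h1 h2.
  have p20 : 0 < p ^+ 2 / 2 by rewrite divr_gt0// exprn_gt0.
  by rewrite /C; lra.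
have [w [W [g [m' [M [m'0 gmM w0 WK dw dW gE ddw]]]]]] :=
  energy_profile_exists dF s1a HC.
have g0 y : 0 < g y by have /andP[+ _] := gmM y; exact: lt_le_trans.
have gs1 : g s1 = p.
  apply: (sqr_inj_pos (g0 _) p0).
  by rewrite gE; [rewrite /C; field|rewrite lexx ltW].
have w_anti x y : x <= y -> w y <= w x.
  by apply: (antitone_derive dw) => z; rewrite oppr_le0 ltW.
pose T := W s1.
have wT : w T = s1 by rewrite /T WK.
have T0 : 0 < T.
  by rewrite ltNge; apply/negP => /w_anti; rewrite w0 wT leNgt s1a.
exists (- g a), (s1 / 2); split.
- by rewrite oppr_lt0.
- rewrite sqrrN gE; last by rewrite lexx ltW.
  by have := sqr_ge0 p; rewrite /C; lra.
- by apply/andP; split; lra.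
move=> s /andP[s0 ss1].
have s1s : 0 < s1 - s by lra.
pose ks := p / (s1 - s).
have ks0 : 0 < ks by rewrite divr_gt0.
have ks_kap : ks <= 2 * kap.
  rewrite /ks ler_pdivrMr// /p -subr_ge0.
  have -> : 2 * kap * (s1 - s) - kap * s1 = kap * (s1 - 2 * s) by ring.
  by rewrite mulr_ge0 ?ltW//; lra.
have ks2 : ks ^+ 2 <= m.
  have : ks ^+ 2 <= (2 * kap) ^+ 2.
    by rewrite lerXn2r// nnegrE; [exact: ltW|rewrite mulr_ge0// ltW].
  have -> : (2 * kap) ^+ 2 = 4 * kap ^+ 2 by ring.
  by rewrite kap2; lra.
pose E x := expR (- ks * (x - T)).
have dE (x : R) : is_derive x 1 E (- ks * E x).
  by apply: is_derive_eq; rewrite /GRing.scale /= /E; ring.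
have E0 x : 0 < E x by exact: expR_gt0.
have E1 x : T <= x -> E x <= 1.
  by move=> Tx; rewrite expR_le1 mulNr oppr_le0 mulr_ge0 ?subr_ge0// ltW.
have ET : E T = 1 by rewrite /E subrr mulr0 expR0.
pose tail x := s + (s1 - s) * E x.
pose tail1 x := - p * E x.
have dtail (x : R) : is_derive x 1 tail (tail1 x).
  have ? := dE x; apply: is_derive_eq; rewrite /GRing.scale /= /tail1 /ks.
  by field; rewrite gt_eqF.
have dtail1 (x : R) : is_derive x 1 tail1 (ks ^+ 2 * (tail x - s)).
  have ? := dE x; apply: is_derive_eq; rewrite /GRing.scale /= /tail /ks.
  by field; rewrite gt_eqF.
have tail_ge x : s <= tail x by rewrite lerDl mulr_ge0// ltW.
have tail_le x : T <= x -> tail x <= s1.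
  move=> /E1 Ex; rewrite /tail.
  have : (s1 - s) * E x <= s1 - s by rewrite ler_piMr// ltW.
  by lra.
pose B x := - g (w x).
have wtail : w T = tail T by rewrite wT /tail ET; ring.
have Btail : B T = tail1 T by rewrite /B wT gs1 /tail1 ET; ring.
pose N := glue T w tail; pose n := glue T B tail1.
have dN (x : R) : is_derive x 1 N (n x).
  apply: glue_derive => // y yT.
    by rewrite /n glue_left//; exact: dw.
  by rewrite /n (glue_right Btail yT); exact: dtail.
have wi x : 0 <= x -> x <= T -> s1 <= w x <= a.
  by move=> h1 h2; rewrite -{1}wT -w0 !w_anti.
exists N, n; split => //.
- by rewrite /N glue_left ?ltW.
- by rewrite /n glue_left ?ltW// /B w0.
- move=> x x0; have [xT|/ltW Tx] := leP x T.
    by rewrite /N glue_left//; have /andP[h _] := wi _ x0 xT; lra.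
  by rewrite /N (glue_right wtail Tx).
- move=> x x0; apply: glue_upper_jet => // xT.
    rewrite /n /N !glue_left//; apply: upper_jet_taylor.
      by near=> y; exact: dw.
    by apply: ddw; exact: wi (ltW x0) xT.
  rewrite /n /N (glue_right Btail xT) (glue_right wtail xT).
  apply: (@upper_jet_le _ _ _ _ (ks ^+ 2 * (tail x - s))).
    have : f (tail x) <= - m * tail x.
      by apply: fm; rewrite tail_le// andbT; have := tail_ge x; lra.
    have : ks ^+ 2 * (tail x - s) <= m * (tail x - s).
      by rewrite ler_wpM2r// subr_ge0.
    have : 0 <= m * s by rewrite mulr_ge0// ltW.
    by lra.
  by apply: (@upper_jet_taylor _ tail tail1); near=> y; exact: dtail.
- move=> e e0; exists (T + (s1 - s) / e / ks) => x Xx.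
  have q0 : 0 < (s1 - s) / e / ks by rewrite !divr_gt0.
  have Tx : T <= x by lra.
  rewrite /N (glue_right wtail Tx) /tail lerD2l /E mulNr expRN.
  rewrite ler_pdivrMr ?expR_gt0//.
  have h1 := expR_ge1Dx (ks * (x - T)).
  have h2 : (s1 - s) / e <= ks * (x - T) by rewrite [leRHS]mulrC -ler_pdivrMr//; lra.
  by rewrite [leRHS]mulrC -ler_pdivrMr//; lra.
Unshelve. all: by end_near. Qed.

End Blocking.

Section BlockingTheorem.
Variables (R : realType) (f F : R -> R) (a : R).
Hypothesis hf : bistable f a.
Hypothesis dF : forall x : R, is_derive x 1 F (f x).
Hypothesis F0 : F 0 = 0.

(** The supersolution is 1 or more on the paths 1 and 5 and on the part of the
edge near the first vertex, where it therefore cannot be touched by [u]. *)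
Theorem blocking : F 1 + 8 * F a < 0 ->
  exists L0 : R, forall L : {posnum R}, L0 < L%:num ->
  forall u : R -> graph_fun R unit 'I_5,
  entire_solution (two_vertex_graph L) f u ->
  (forall t e x, edge_dom (two_vertex_graph L) e x -> 0 < u t e x < 1) ->
  (forall s, 0 < s -> exists t0, forall e x, e != inr Omega1 ->
     edge_dom (two_vertex_graph L) e x -> u t0 e x <= s) ->
  forall d, 0 < d -> exists t0 X, forall t j x, t0 <= t ->
    j \in [:: Omega2; Omega3; Omega4] -> X <= x -> 0 <= x ->
    u t (inr j) x <= d.
Proof.
move=> Fneg; have /andP[a0 a1] := bistable_a hf.
have [K K0 fK] := bistable_lipschitz hf.
pose mu := - (F 1 + 8 * F a).
have mu0 : 0 < mu by rewrite /mu; lra.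
(* With this energy the profile reaches a from 1 within a finite length. *)
pose C := F 1 + mu / 4.
have HC y : a <= y <= 1 -> F y < C.
  move=> /andP[h1 h2].
  by have := potential_nondecreasing hf dF h1 h2 (lexx 1); rewrite /C; lra.
have [w [W [g [m [M [m0 gmM w0 WK dw dW gE ddw]]]]]] :=
  energy_profile_exists dF a1 HC.
have g0 y : 0 < g y by have /andP[+ _] := gmM y; exact: lt_le_trans.
have w_anti x y : x <= y -> w y <= w x.
  by apply: (antitone_derive dw) => z; rewrite oppr_le0 ltW.
have eta0 : 0 < mu / 6 by rewrite divr_gt0.
have [sl [s0 [sl0 sl2 /andP[s00 s0a] tailP]]] :=
  decaying_profile_exists hf dF F0 eta0.
pose TK := W a; have wTK : w TK = a by rewrite /TK WK.
exists TK => L TKL u usol u01 u_start d d0.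
(* Translation which makes the profile reach a at the end of the edge. *)
pose D := TK - L%:num; have D0 : D < 0 by rewrite /D; lra.
have wD x : x + D <= 0 -> 1 <= w (x + D) by rewrite -w0; exact: w_anti.
pose s := Num.min (s0 / 2) (d / 2).
have sp : 0 < s by rewrite lt_min !divr_gt0.
have ss0 : s <= s0 / 2 by rewrite ge_min lexx.
have sd : s <= d / 2 by rewrite ge_min lexx orbT.
have [N [n [N0 n0 dN Nge jN Nsmall]]] := tailP s ltac:(apply/andP; split; lra).
pose isol (j : 'I_5) := (j == Omega1) || (j == Omega5).
pose w' : graph_fun R unit 'I_5 := fun e x => match e with
  | inl _ => w (x + D) | inr j => if isol j then w D else N x end.
pose w1 : graph_fun R unit 'I_5 := fun e x => match e with
  | inl _ => - g (w (x + D)) | inr j => if isol j then 0 else n x end.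
have dw' e (x : R) : is_derive x 1 (w' e) (w1 e x).
  rewrite /w' /w1; case: e => [i|j].
    exact: is_derive_translate (dw (x + D)).
  by case: (isol j); [exact: (is_derive_cst (w D))|exact: dN].
have [t0 ut0] := u_start s sp.
have [X NX] := Nsmall s sp.
pose G := two_vertex_graph L.
have w'_ge e x : edge_dom G e x -> s <= w' e x.
  case: e => [i|j] /= xe.
    have : w TK <= w (x + D) by apply: w_anti; rewrite /D; move/andP: xe; lra.
    by rewrite wTK; lra.
  by case: ifP => _; [have := wD 0; rewrite add0r; lra|exact: Nge].
have sv : single_valued_at_vertices G w'.
  apply: single_valued_two_vertex => /=; rewrite ?add0r//.
  - by rewrite N0 /D addrC subrK wTK.
  - by rewrite N0 /D addrC subrK wTK.
  - by rewrite N0 /D addrC subrK wTK.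
have above t e x : t0 <= t -> edge_dom G e x -> u t e x <= w' e x.
  move=> t0t; apply: (@supersolution_above R _ _ _ G f u K K0 fK usol u01
    (fun=> w') t0 t); last by rewrite t0t lexx.
  - move=> e'; apply: continuous_subspaceT => p.
    apply: (@continuous_comp _ _ _ snd (w' e')); first exact: cvg_snd.
    exact: (derive_continuous (dw' e')).
  - by [].
  - by move=> _ e' y _ /w'_ge; lra.
  - move=> e' y ye; have [e'1|e1] := eqVneq e' (inr Omega1).
      move: ye; rewrite e'1 => ye'.
      have w1D := wD 0; rewrite add0r in w1D.
      by apply: le_trans (w1D (ltW D0)); apply/ltW; have /andP[] := u01 t0 _ _ ye'.
    by apply: le_trans (ut0 _ _ e1 ye) (w'_ge _ _ ye).
  - move=> t' e' y _ yi wu; have ye := edge_interior_dom yi.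
    exists 0, (w1 e' y), (- f (w' e' y)); split.
    + exact: static_quotient.
    + move: yi ye wu; rewrite /w' /w1; case: e' => [i|j] yi ye wu.
        have u1 : u t' (inl i) y < 1 by have /andP[] := u01 t' _ _ ye.
        apply: (@upper_jet_taylor _ (fun x => w (x + D)) (fun x => - g (w (x + D)))).
          by near=> z; exact: is_derive_translate (dw (z + D)).
        apply: (@is_derive_translate _ (fun y => - g (w y))); apply: ddw.
        apply/andP; split; last by apply: ltW; exact: lt_trans u1.
        by rewrite -wTK; apply: w_anti; rewrite /D; move/andP: ye => [_ /=]; lra.
      have u1 : u t' (inr j) y < 1 by have /andP[] := u01 t' _ _ ye.
      move: wu; case: (isol j) => wu; last exact: jN.
      have := wD 0; rewrite add0r => /(_ (ltW D0)); lra.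
    + by rewrite addrC subrr.
  - by move=> t' _; exact: graph_derivable_of dw'.
  - move=> t' P _; have [->|->] := vertex_cases P.
      move=> /negative_at_P1; rewrite /w' /=.
      have := u01 t' (inr Omega1) 0 (lexx 0).
      by have := wD 0; rewrite add0r => /(_ (ltW D0)); lra.
    move=> _; rewrite kirchhoff_sum_P2.
    have px e' (y : R) : edge_dom G e' y -> partial_x G w' e' y = w1 e' y.
      by move=> ye; have := partial_x_of ye dw'.
    rewrite !px; [|exact: edge_dom0..|exact: edge_dom_len].
    have LD : L%:num + D = TK by rewrite /D addrC subrK.
    rewrite /w1 /= n0 opprK LD wTK.
    have ga : g a ^+ 2 = 2 * (C - F a) by rewrite gE// lexx ltW.
    (* 2 (F 1 + mu / 4 - F a) <= 9 (- 2 F a - mu / 6), by the definition of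
       mu. *)
    have h : g a ^+ 2 <= (- 3 * sl) ^+ 2.
      by rewrite ga /C exprMn; move: sl2; rewrite /mu; lra.
    have : g a <= - 3 * sl.
      rewrite -ler_sqr ?nnegrE//; first exact: ltW.
      by rewrite mulr_le0// ?ltW// oppr_lt0.
    by lra.
exists t0, X => t j x t0t jin Xx x0.
have := above t (inr j) x t0t x0; have := NX x Xx.
rewrite /w' /isol; move: jin; rewrite !inE => /or3P[/eqP->|/eqP->|/eqP->] /=; lra.
Unshelve. all: by end_near. Qed.

End BlockingTheorem.

(** * Slowly moving fronts *)

Section FrontShape.
Variables (R : realType) (top k z0 : R) (w g : R -> R).
Hypothesis k_gt0 : 0 < k.
Hypothesis z0_gt0 : 0 < z0.
Hypothesis g_gt0 : forall y, 0 < g y.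
Hypothesis w_derive : forall x : R, is_derive x 1 w (- g (w x)).
Hypothesis w_start : w 0 = top - k / 2 * z0 ^+ 2.
Hypothesis g_start : g (w 0) = k * z0.
Implicit Types x y z : R.

Let cap z := top - k / 2 * z ^+ 2.
Let tail z := w (z - z0).
Let cap_slope z := - (k * z).
Let tail_slope z := - g (tail z).

(** A plateau, a parabolic cap and a profile of given energy, glued so that
the derivative is continuous.  The cap is needed because w' = - g(w) does not
leave the plateau, where the slope vanishes. *)
Definition front_shape := glue 0 (cst top) (glue z0 cap tail).
Definition front_slope := glue 0 (cst 0) (glue z0 cap_slope tail_slope).

Let cap_tail : cap z0 = tail z0.
Proof. by rewrite /cap /tail subrr w_start. Qed.

Let slope_cap_tail : cap_slope z0 = tail_slope z0.
Proof. by rewrite /cap_slope /tail_slope /tail subrr g_start. Qed.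

Let top_cap : cst top (0 : R) = glue z0 cap tail 0.
Proof. by rewrite glue_left ?ltW// /cap expr0n mulr0 subr0. Qed.

Let slope_top_cap : cst 0 (0 : R) = glue z0 cap_slope tail_slope 0.
Proof. by rewrite glue_left ?ltW// /cap_slope mulr0 oppr0. Qed.

Lemma front_shape_top z : z <= 0 -> front_shape z = top.
Proof. by move=> z_le0; rewrite /front_shape glue_left. Qed.

Lemma front_shape_cap z : 0 <= z -> z <= z0 ->
  front_shape z = top - k / 2 * z ^+ 2.
Proof.
by move=> z_ge0 zz0; rewrite /front_shape (glue_right top_cap z_ge0) glue_left.
Qed.

Lemma front_shape_tail z : z0 <= z -> front_shape z = w (z - z0).
Proof.
move=> z0z; have z_ge0 : 0 <= z by exact: le_trans (ltW z0_gt0) z0z.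
by rewrite /front_shape (glue_right top_cap z_ge0) (glue_right cap_tail z0z).
Qed.

Lemma front_slope_top z : z <= 0 -> front_slope z = 0.
Proof. by move=> z_le0; rewrite /front_slope glue_left. Qed.

Lemma front_slope_cap z : 0 <= z -> z <= z0 -> front_slope z = - (k * z).
Proof.
by move=> z_ge0 zz0; rewrite /front_slope (glue_right slope_top_cap z_ge0) glue_left.
Qed.

Lemma front_slope_tail z : z0 <= z -> front_slope z = - g (w (z - z0)).
Proof.
move=> z0z; have z_ge0 : 0 <= z by exact: le_trans (ltW z0_gt0) z0z.
by rewrite /front_slope (glue_right slope_top_cap z_ge0) (glue_right slope_cap_tail z0z).
Qed.

Lemma front_shape_derive (z : R) : is_derive z 1 front_shape (front_slope z).
Proof.
apply: glue_derive => // y y_0.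
  by rewrite front_slope_top//; exact: is_derive_cst.
rewrite /front_slope (glue_right slope_top_cap y_0).
apply: glue_derive => // x x_z0.
  by rewrite glue_left//; apply: is_derive_eq; rewrite /GRing.scale/= /cap_slope; field.
rewrite (glue_right slope_cap_tail x_z0).
exact: is_derive_translate (w_derive (x - z0)).
Qed.

Lemma front_slope_le0 z : front_slope z <= 0.
Proof.
have [z_|/ltW z_] := leP z 0; first by rewrite front_slope_top.
have [zz0|/ltW zz0] := leP z z0; last by rewrite front_slope_tail// oppr_le0 ltW.
by rewrite front_slope_cap// oppr_le0 mulr_ge0// ltW.
Qed.

Lemma front_shape_anti x y : x <= y -> front_shape y <= front_shape x.
Proof. exact: (antitone_derive front_shape_derive front_slope_le0). Qed.

Lemma front_shape_le z : front_shape z <= top.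
Proof.
have [z_|/ltW z_] := leP z 0; first by rewrite front_shape_top.
by rewrite -(front_shape_top (lexx 0)) front_shape_anti.
Qed.

(** On the plateau and on the cap the values exceed w 0. *)
Lemma front_shape_low z : front_shape z <= w 0 -> z0 <= z.
Proof.
move=> Pz; rewrite leNgt; apply/negP => zz0.
have kz : 0 < k / 2 * z0 ^+ 2 by rewrite mulr_gt0 ?divr_gt0 ?exprn_gt0.
have [z_|/ltW z_] := leP z 0.
  by move: Pz; rewrite front_shape_top// w_start; lra.
have : k / 2 * z ^+ 2 < k / 2 * z0 ^+ 2 by rewrite ltr_pM2l ?divr_gt0// ltrXn2r.
by move: Pz; rewrite (front_shape_cap z_ (ltW zz0)) w_start; lra.
Qed.

Lemma front_shape_jet (f : R -> R) delta z :
  delta <= f top -> (forall x, 0 <= x <= z0 -> delta + k <= f (cap x)) ->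
  (z0 <= z -> is_derive (z - z0) 1 (fun x => - g (w x))
     (delta - f (w (z - z0)))) ->
  lower_jet front_shape z (front_slope z) (delta - f (front_shape z)).
Proof.
move=> ftop fcap ftail; apply: glue_lower_jet => // z_.
  rewrite front_slope_top// front_shape_top//.
  apply: (@lower_jet_le _ _ _ _ 0); first by rewrite subr_le0.
  move=> e e0; near=> y; rewrite /cst mul0r addr0 sub0r !mulNr gerBl.
  by rewrite mulr_ge0 ?sqr_ge0// divr_ge0// ltW.
apply: glue_lower_jet => // zz0.
  rewrite front_slope_cap// front_shape_cap//.
  apply: (@lower_jet_le _ _ _ _ (- k)).
    have : delta + k <= f (cap z) by apply: fcap; rewrite z_.
    by rewrite /cap; lra.
  move=> e e0; near=> y; rewrite /cap -subr_ge0.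
  have -> : top - k / 2 * y ^+ 2 - (top - k / 2 * z ^+ 2 + - (k * z) * (y - z) +
      (- k - e) / 2 * (y - z) ^+ 2) = e / 2 * (y - z) ^+ 2 by field.
  by rewrite mulr_ge0 ?sqr_ge0// divr_ge0// ltW.
rewrite front_slope_tail// front_shape_tail//.
apply: (@lower_jet_taylor _ tail tail_slope).
  by near=> y; exact: is_derive_translate (w_derive (y - z0)).
exact: (@is_derive_translate _ (fun x => - g (w x)) _ _ _ (ftail zz0)).
Unshelve. all: by end_near. Qed.

End FrontShape.

Section Front.
Variable R : realType.

(** A subsolution shaped as a descending front, with derivative [p] and with
inverse [W] below the value [b].  The strictness [delta] absorbs the time
derivative of a slow translation.  The two energy bounds compare the slope at
a value y with the exact one, whose square is 2 (F top - F y). *)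
Record front (f F : R -> R) (b top delta : R) (P p W : R -> R) (T m M : R)
  : Prop := Front {
  fr_m : 0 < m;
  fr_plateau : forall z, z <= 0 -> P z = top;
  fr_flat : forall z, z <= 0 -> p z = 0;
  fr_le : forall z, P z <= top;
  fr_anti : forall x y, x <= y -> P y <= P x;
  fr_zero : P T = 0;
  fr_derive : forall z : R, is_derive z 1 P (p z);
  fr_bound : forall z, - M <= p z <= 0;
  fr_steep : forall z, P z <= b -> p z <= - m;
  fr_jet : forall z, 0 < P z -> lower_jet P z (p z) (delta - f (P z));
  fr_energy : forall z, 0 <= P z -> p z ^+ 2 <= 2 * (F top - F (P z));
  fr_energy_low : forall z, 0 <= P z <= b ->
    2 * (F b - F (P z) - delta) <= p z ^+ 2;
  fr_WK : forall y, y <= b -> P (W y) = y;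
  fr_dW : forall y : R, y <= b -> is_derive y 1 W (p (W y))^-1 }.

(** Below [b] the front is a profile of w'' + f(w) = delta; its energy is
fixed by the slope of the cap at the value [b]. *)
Lemma front_exists (f F : R -> R) (a b top delta0 : R) :
  bistable f a -> (forall x : R, is_derive x 1 F (f x)) -> F 0 = 0 ->
  a < b -> b < top -> top < 1 -> 0 <= F b -> 0 < delta0 ->
  exists delta P p W T m M, 0 < delta <= delta0 /\
    front f F b top delta P p W T m M.
Proof.
move=> hf dF F0 ab btop top1 Fb delta00.
have /andP[a0 a1] := bistable_a hf.
have [mf [mf0 fmf]] : exists mf, 0 < mf /\ forall y, b <= y <= top -> mf <= f y.
  have [c] := @EVT_min R f b top (ltW btop)
    (continuous_subspaceT (bistable_continuous hf)).
  rewrite in_itv /= => /andP[bc ctop] cmin; exists (f c); split.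
    by apply: (bistable_pos hf); apply/andP; split; lra.
  by move=> y yi; apply: cmin; rewrite in_itv.
have [delta [d0 dd0 dmf dk]] : exists delta, [/\ 0 < delta, delta <= delta0,
    delta <= mf / 2 & delta <= mf / 2 * (top - b) / 2].
  exists (Num.min delta0 (Num.min (mf / 2) (mf / 2 * (top - b) / 2))).
  by rewrite !lt_min !ge_min !lexx delta00 !divr_gt0 ?mulr_gt0 ?subr_gt0 ?divr_gt0// !orbT.
have [k [k0 kmf]] : exists k, 0 < k /\ k = mf / 2 by exists (mf / 2); rewrite divr_gt0.
rewrite -kmf in dmf dk.
have [z0 [z00 kz0]] : exists z0, 0 < z0 /\ k / 2 * z0 ^+ 2 = top - b.
  exists (Num.sqrt (2 * (top - b) / k)).
  have p0 : 0 < 2 * (top - b) / k by rewrite divr_gt0// mulr_gt0// subr_gt0.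
  rewrite sqrtr_gt0 p0 sqr_sqrtr ?ltW//; split=> //.
  by field; rewrite gt_eqF.
have Ftop y : b <= y <= top -> mf * (top - y) <= F top - F y.
  move=> /andP[by_ ytop].
  have [d /andP[yd dtop] ->] := mean_value ytop (fun z _ => dF z).
  by rewrite ler_wpM2r ?subr_ge0//; apply: fmf; rewrite (le_trans by_ yd).
pose H y := F y - delta * y.
pose C := H b + k * (top - b).
have dH (y : R) : is_derive y 1 H (f y - delta).
  by have ? := dF y; apply: is_derive_eq; rewrite /GRing.scale/=; ring.
have CH y : 0 <= y <= b ->
    2 * (F b - F y - delta) <= 2 * (C - H y) <= 2 * (F top - F y) /\ H y < C.
  move=> yi; have FbF : F y <= F b.
    by apply: (potential_le_top hf dF F0) => //; rewrite (ltW ab) ltW// (lt_trans btop).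
  have h1 := Ftop b; rewrite lexx (ltW btop) in h1; have {}h1 := h1 isT.
  case/andP: yi => y0 yb; rewrite /C /H.
  have h2 : 0 <= delta * (b - y) <= delta.
    by rewrite mulr_ge0 ?subr_ge0 ?(ltW d0)// ler_piMr ?(ltW d0)//; lra.
  case/andP: h2 => h2 h3; have h4 : 0 < k * (top - b) by rewrite mulr_gt0// subr_gt0.
  have h5 : mf * (top - b) = 2 * (k * (top - b)) by rewrite kmf; field.
  by split; [apply/andP; split|]; lra.
have [w [W0 [g [m [M [m0 gmM w0 WK dw dW gE ddw]]]]]] :=
  energy_profile_exists dH (lt_trans a0 ab) (fun y yi => (CH y yi).2).
have g0 y : 0 < g y by have /andP[+ _] := gmM y; exact: lt_le_trans.
have g_le0 y : - g y <= 0 by rewrite oppr_le0 ltW.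
have b_gt0 : 0 < b by exact: lt_trans ab.
have w_start : w 0 = top - k / 2 * z0 ^+ 2 by rewrite w0 kz0 opprB addrC subrK.
have g_start : g (w 0) = k * z0.
  apply: (sqr_inj_pos (g0 _)); first by rewrite mulr_gt0.
  rewrite w0 gE; last by rewrite lexx ltW.
  have -> : (k * z0) ^+ 2 = k * (2 * (k / 2 * z0 ^+ 2)) by field.
  by rewrite kz0 /C; ring.
have w_anti x y : x <= y -> w y <= w x.
  exact: (antitone_derive dw (fun x => g_le0 (w x))).
have w_pos x : w x <= b -> 0 <= x.
  move=> wxb; rewrite leNgt; apply/negP => x0.
  have [d _ E] := mean_value (ltW x0) (fun z _ => dw z).
  have : w 0 - w x < 0 by rewrite E pmulr_llt0 ?subr_gt0// oppr_lt0.
  by rewrite w0 subr_lt0 ltNge wxb.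
pose P := front_shape top k z0 w; pose p := front_slope k z0 w g.
have P_top z : z <= 0 -> P z = top by exact: front_shape_top.
have P_cap z : 0 <= z -> z <= z0 -> P z = top - k / 2 * z ^+ 2.
  exact: front_shape_cap.
have P_tail z : z0 <= z -> P z = w (z - z0) by exact: front_shape_tail.
have p_top z : z <= 0 -> p z = 0 by exact: front_slope_top.
have p_cap z : 0 <= z -> z <= z0 -> p z = - (k * z) by exact: front_slope_cap.
have p_tail z : z0 <= z -> p z = - g (w (z - z0)) by exact: front_slope_tail.
have P_le z : P z <= top by exact: (@front_shape_le _ _ _ _ _ g).
have P_low z : P z <= b -> z0 <= z.
  by rewrite -w0; exact: front_shape_low.
have cap_i x : 0 <= x <= z0 -> b <= top - k / 2 * x ^+ 2 <= top.
  move=> /andP[x0 xz0].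
  have h1 : 0 <= k / 2 * x ^+ 2 by rewrite mulr_ge0 ?sqr_ge0// divr_ge0// ltW.
  have h2 : k / 2 * x ^+ 2 <= k / 2 * z0 ^+ 2.
    by rewrite ler_pM2l ?divr_gt0// lerXn2r// nnegrE ltW.
  by move: h2; rewrite kz0 => h2; apply/andP; split; lra.
pose W y := z0 + W0 y.
have W_z0 y : y <= b -> z0 <= W y.
  by move=> yb; rewrite /W lerDl; apply: w_pos; rewrite WK.
have wW y : w (W y - z0) = y by rewrite /W addrC addKr WK.
have PW y : y <= b -> P (W y) = y by move=> yb; rewrite P_tail ?wW// W_z0.
have w_le z : z0 <= z -> w (z - z0) <= b by move=> h; rewrite -w0 w_anti// subr_ge0.
exists delta, P, p, W, (W 0), m, (k * z0 + M); split; first by rewrite d0.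
split => //.
- by move=> x y; apply: (@front_shape_anti _ _ _ _ _ g).
- by rewrite PW// ltW.
- by move=> z; exact: front_shape_derive.
- move=> z; have -> : p z <= 0 by exact: front_slope_le0.
  rewrite andbT lerNl.
  have M0 : 0 <= M by have /andP[+ +] := gmM 0 => h1 h2; rewrite ltW// (lt_le_trans m0 (le_trans h1 h2)).
  have kz00 : 0 <= k * z0 by rewrite mulr_ge0// ltW.
  have [z_|/ltW z_] := leP z 0; first by rewrite p_top// oppr0 addr_ge0.
  have [zz0|/ltW zz0] := leP z z0.
    by rewrite p_cap// opprK ler_wpDr// ler_pM2l.
  by rewrite p_tail// opprK ler_wpDl//; have /andP[_] := gmM (w (z - z0)).
- by move=> z /P_low zz0; rewrite p_tail// lerN2; have /andP[] := gmM (w (z - z0)).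
- move=> z Pz0; apply: front_shape_jet => //.
  + apply: (le_trans dmf); apply: (@le_trans _ _ mf).
      by rewrite kmf ler_pdivrMr// ler_pMr// ler1n.
    by apply: fmf; rewrite lexx ltW.
  + move=> x /cap_i /fmf; apply: le_trans.
    by apply: (@le_trans _ _ (k + k)); [rewrite lerD2r|rewrite kmf -splitr].
  + move=> zz0; rewrite -[delta - _]opprB; apply: ddw; rewrite w_le// andbT.
    by rewrite -P_tail// ltW.
- move=> z Pz0; have [z_|/ltW z_] := leP z 0.
    by rewrite p_top// P_top// subrr mulr0 expr0n.
  have [zz0|/ltW zz0] := leP z z0.
    rewrite p_cap// P_cap// sqrrN.
    have := Ftop _ (cap_i z _); rewrite z_ zz0 => /(_ isT).
    have -> : (k * z) ^+ 2 = mf * (k / 2 * z ^+ 2) by rewrite kmf; field.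
    have : 0 <= mf * (k / 2 * z ^+ 2).
      by rewrite mulr_ge0 ?(ltW mf0)// mulr_ge0 ?sqr_ge0// divr_ge0// ltW.
    by move: (k / 2 * z ^+ 2) => q; clear; lra.
  rewrite p_tail// sqrrN P_tail//; move: Pz0; rewrite P_tail// => wz0.
  have wi : 0 <= w (z - z0) <= b by rewrite wz0 w_le.
  by rewrite gE//; have [/andP[]] := CH _ wi.
- move=> z /andP[Pz0 Pzb]; have zz0 := P_low _ Pzb.
  rewrite p_tail// sqrrN P_tail//; move: Pz0; rewrite P_tail// => wz0.
  have wi : 0 <= w (z - z0) <= b by rewrite wz0 w_le.
  by rewrite gE//; have [/andP[]] := CH _ wi.
- move=> y yb; rewrite p_tail ?W_z0// wW invrN.
  by have := dW y => ?; apply: is_derive_eq; rewrite add0r mul1r.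
Qed.

End Front.

(** * Crossing of the first vertex *)

Section Propagation.
Variables (R : realType) (f F : R -> R) (a : R).
Hypothesis hf : bistable f a.
Hypothesis dF : forall x : R, is_derive x 1 F (f x).
Hypothesis F0 : F 0 = 0.
Hypothesis F1 : 0 < F 1.

Lemma potential_value v : F a <= v -> v <= F 1 -> exists2 y, a <= y <= 1 & F y = v.
Proof.
move=> h1 h2; have /andP[_ a1] := bistable_a hf.
have [|y + <-] := @IVT R F a 1 v (ltW a1) (continuous_subspaceT (derive_continuous dF)).
  by rewrite ge_min le_max h1 h2 orbT.
by rewrite in_itv => yi; exists y.
Qed.

Lemma potential_lt x y : a <= x <= 1 -> a <= y <= 1 -> F x < F y -> x < y.
Proof.
move=> /andP[ax x1] /andP[ay y1] Fxy; rewrite ltNge; apply/negP => yx.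
by have := potential_nondecreasing hf dF ay yx x1; rewrite leNgt Fxy.
Qed.

(** The parameters are chosen so that F theta <= mu / 16 and F 1 - F bQ <= mu
/ 4, deltaQ <= mu / 8, where mu = F 1 + 3 F a.  The last clause then says that
the slope of Q at a value alpha is at least twice the slope of P at the same
value. *)
Lemma fronts_exist : 0 < F 1 + 3 * F a ->
  exists bP theta deltaP P p WP TP mP MP bQ beta deltaQ Q q WQ TQ mQ MQ,
  [/\ 0 < deltaP /\ 0 < deltaQ, front f F bP theta deltaP P p WP TP mP MP,
    front f F bQ beta deltaQ Q q WQ TQ mQ MQ,
    [/\ a < bP, bP < theta, theta < bQ, bQ < beta & beta < 1] &
    forall alpha, 0 <= alpha <= 1 ->
      4 * (F theta - F alpha) <= F bQ - F alpha - deltaQ].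
Proof.
move=> mu0; set mu := F 1 + 3 * F a in mu0.
have /andP[a0 a1] := bistable_a hf.
have Fa0 : F a <= 0.
  by rewrite -F0; apply: (potential_nonincreasing hf dF) => //; exact: ltW.
pose v1 := Num.min (mu / 16) (F 1 / 2).
have v10 : 0 < v1 by rewrite lt_min !divr_gt0.
have v1mu : v1 <= mu / 16 by rewrite ge_min lexx.
have v1F : v1 <= F 1 / 2 by rewrite ge_min lexx orbT.
clearbody v1.
pose v2 := Num.min (mu / 4) (F 1 / 4).
have v20 : 0 < v2 by rewrite lt_min !divr_gt0.
have v2mu : v2 <= mu / 4 by rewrite ge_min lexx.
have v2F : v2 <= F 1 / 4 by rewrite ge_min lexx orbT.
clearbody v2.
have [theta thi Fth] : exists2 y, a <= y <= 1 & F y = v1.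
  by apply: potential_value; lra.
have [bP bPi FbP] : exists2 y, a <= y <= 1 & F y = v1 / 2.
  by apply: potential_value; lra.
have [bQ bQi FbQ] : exists2 y, a <= y <= 1 & F y = F 1 - v2.
  by apply: potential_value; lra.
have ai : a <= a <= 1 by apply/andP; split; lra.
have i1 : a <= (1 : R) <= 1 by apply/andP; split; lra.
have abP : a < bP by apply: potential_lt => //; lra.
have bPth : bP < theta by apply: potential_lt => //; lra.
have thbQ : theta < bQ by apply: potential_lt => //; lra.
have bQ1 : bQ < 1 by apply: potential_lt => //; lra.
pose beta := (bQ + 1) / 2.
have bQb : bQ < beta by rewrite /beta; lra.
have b1 : beta < 1 by rewrite /beta; lra.
have th1 : theta < 1 by lra.
have FbP0 : 0 <= F bP by rewrite FbP; lra.
have FbQ0 : 0 <= F bQ by rewrite FbQ; lra.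
have abQ : a < bQ by lra.
have mu80 : 0 < mu / 8 by rewrite divr_gt0.
have [deltaP [P [p [WP [TP [mP [MP [/andP[dP0 _] frP]]]]]]]] :=
  front_exists hf dF F0 abP bPth th1 FbP0 ltr01.
have [deltaQ [Q [q [WQ [TQ [mQ [MQ [/andP[dQ0 dQ1] frQ]]]]]]]] :=
  front_exists hf dF F0 abQ bQb b1 FbQ0 mu80.
exists bP, theta, deltaP, P, p, WP, TP, mP, MP.
exists bQ, beta, deltaQ, Q, q, WQ, TQ, mQ, MQ; split => //.
move=> alpha /(potential_ge_Fa hf dF) Fal.
by rewrite Fth FbQ; rewrite /mu in v1mu v2mu dQ1; lra.
Qed.

End Propagation.

Section MovingFronts.
Variables (R : realType) (f F : R -> R) (L : {posnum R}).
Variables (bP theta deltaP : R) (P p WP : R -> R) (TP mP MP : R).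
Variables (bQ beta deltaQ : R) (Q q WQ : R -> R) (TQ mQ MQ eps : R).
Hypothesis frP : front f F bP theta deltaP P p WP TP mP MP.
Hypothesis frQ : front f F bQ beta deltaQ Q q WQ TQ mQ MQ.
Hypothesis theta_bQ : theta < bQ.
Hypothesis beta_le1 : beta <= 1.
Hypothesis theta_le1 : theta <= 1.
Hypothesis eps_gt0 : 0 < eps.
Implicit Types (s x t : R) (e : (unit + 'I_5)%type).
Notation G := (two_vertex_graph L).

(** Position of the front on the edge: it advances until its plateau reaches
the first vertex, and rests afterwards. *)
Definition stopped_shift s := Num.min (eps * s) 0.

(** Position of the incoming front for which it takes at the first vertex the
same value as the outgoing front. *)
Definition matched_shift s := WQ (P (- (eps * s))).

(** The value on the paths 2, 3 and 4 is the one required by continuity at the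
second vertex; it is nonpositive, hence below any positive solution. *)
Definition crossing_front s : graph_fun R unit 'I_5 := fun e x =>
  match e with
  | inl _ => P (x - stopped_shift s)
  | inr j => if j == Omega1 then Q (- x + matched_shift s)
             else if j == Omega5 then P (x - eps * s)
             else P (L%:num - stopped_shift s)
  end.

Definition crossing_slope s : graph_fun R unit 'I_5 := fun e x =>
  match e with
  | inl _ => p (x - stopped_shift s)
  | inr j => if j == Omega1 then - q (- x + matched_shift s)
             else if j == Omega5 then p (x - eps * s) else 0
  end.

Let matched_shift1 s := (q (matched_shift s))^-1 * (- eps * p (- (eps * s))).

Let P_lt_bQ z : P z < bQ.
Proof. exact: le_lt_trans (fr_le frP z) theta_bQ. Qed.

Lemma matched_shiftK s : Q (matched_shift s) = P (- (eps * s)).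
Proof. by rewrite (fr_WK frQ)// ltW. Qed.

Lemma matched_shift_steep s : q (matched_shift s) <= - mQ.
Proof. by apply: (fr_steep frQ); rewrite matched_shiftK ltW. Qed.

Lemma moving_front_derive x s :
  is_derive s 1 (fun s => P (x - eps * s)) (- eps * p (x - eps * s)).
Proof.
have ? : is_derive s 1 (fun s => x - eps * s) (- eps).
  by apply: is_derive_eq; rewrite /GRing.scale /=; ring.
by rewrite mulrC; apply: (@is_derive1_comp _ P); exact: (fr_derive frP).
Qed.

Lemma matched_shift_derive s : is_derive s 1 matched_shift (matched_shift1 s).
Proof.
have ? : is_derive s 1 (fun s => P (- (eps * s))) (- eps * p (- (eps * s))).
  have := moving_front_derive 0 s; rewrite sub0r.
  by have -> : (fun s => P (0 - eps * s)) = (fun s => P (- (eps * s)))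
    by apply/funext => r; rewrite sub0r.
by apply: (@is_derive1_comp _ WQ); apply: (fr_dW frQ); rewrite ltW.
Qed.

Lemma crossing_derive s e x :
  is_derive x 1 (crossing_front s e) (crossing_slope s e x).
Proof.
rewrite /crossing_front /crossing_slope; case: e => [i|j].
  exact: is_derive_translate (fr_derive frP _).
case: (j == Omega1); first exact: is_derive_reflect (fr_derive frQ _).
case: (j == Omega5); first exact: is_derive_translate (fr_derive frP _).
exact: is_derive_cst.
Qed.

Lemma crossing_continuous d e :
  continuous (fun pt : R * R => crossing_front (pt.1 + d) e pt.2).
Proof.
have cP : continuous P := derive_continuous (fr_derive frP).
have cQ : continuous Q := derive_continuous (fr_derive frQ).
have cxi : continuous matched_shift := derive_continuous matched_shift_derive.
have csg : continuous stopped_shift.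
  move=> s; apply: (@continuous_min _ _ (fun s => eps * s) (cst 0)).
    by apply: cvgM; [exact: cvg_cst|exact: cvg_id].
  exact: cvg_cst.
move=> pt; rewrite /crossing_front.
have c1 : (x.1 + d) @[x --> pt] --> pt.1 + d.
  by apply: cvgD; [exact: cvg_fst|exact: cvg_cst].
have c2 : snd x @[x --> pt] --> pt.2 by exact: cvg_snd.
have csg1 : stopped_shift (x.1 + d) @[x --> pt] --> stopped_shift (pt.1 + d).
  apply: (@continuous_comp _ _ _ (fun x : R * R => x.1 + d) stopped_shift) => //.
  exact: csg.
have cxi1 : matched_shift (x.1 + d) @[x --> pt] --> matched_shift (pt.1 + d).
  apply: (@continuous_comp _ _ _ (fun x : R * R => x.1 + d) matched_shift) => //.
  exact: cxi.
case: e => [i|j].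
  apply: (@continuous_comp _ _ _
    (fun pt : R * R => pt.2 - stopped_shift (pt.1 + d)) P); last exact: cP.
  exact: cvgB.
case: (j == Omega1).
  apply: (@continuous_comp _ _ _
    (fun pt : R * R => - pt.2 + matched_shift (pt.1 + d)) Q); last exact: cQ.
  by apply: cvgD => //; exact: cvgN.
case: (j == Omega5).
  apply: (@continuous_comp _ _ _
    (fun pt : R * R => pt.2 - eps * (pt.1 + d)) P); last exact: cP.
  by apply: cvgB => //; apply: cvgM => //; exact: cvg_cst.
apply: (@continuous_comp _ _ _
  (fun pt : R * R => L%:num - stopped_shift (pt.1 + d)) P); last exact: cP.
by apply: cvgB => //; exact: cvg_cst.
Qed.

Lemma stopped_shift_le0 s : stopped_shift s <= 0.
Proof. by rewrite ge_min lexx orbT. Qed.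

(** After the stop both arguments are on the plateau. *)
Lemma stopped_value s : P (- stopped_shift s) = P (- (eps * s)).
Proof.
rewrite /stopped_shift; have [//|h] := leP (eps * s) 0.
by rewrite !(fr_plateau frP)// ?oppr0// oppr_le0 ltW.
Qed.

Lemma stopped_slope s : p (- stopped_shift s) = p (- (eps * s)).
Proof.
rewrite /stopped_shift; have [//|h] := leP (eps * s) 0.
by rewrite !(fr_flat frP)// ?oppr0// oppr_le0 ltW.
Qed.

Lemma crossing_single_valued s : single_valued_at_vertices G (crossing_front s).
Proof.
apply: single_valued_two_vertex => //=.
  by rewrite oppr0 add0r sub0r matched_shiftK stopped_value.
by rewrite !sub0r stopped_value.
Qed.

Lemma crossing_le1 s e x : crossing_front s e x <= 1.
Proof.
have P1 z : P z <= 1 by exact: le_trans (fr_le frP z) theta_le1.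
rewrite /crossing_front; case: e => [i|j]; first exact: P1.
case: (j == Omega1); first exact: le_trans (fr_le frQ _) beta_le1.
by case: (j == Omega5); exact: P1.
Qed.

Lemma crossing_beyond s : TP <= L%:num -> P (L%:num - stopped_shift s) <= 0.
Proof.
move=> TPL; rewrite -(fr_zero frP) (fr_anti frP)// (le_trans TPL)//.
by rewrite lerDl oppr_ge0 stopped_shift_le0.
Qed.

(** The time derivative is at most eps MP on the path 5 and on the edge, and
at most eps MP MQ / mQ on the path 1, where the speed of the front is that of
P multiplied by the ratio of the slopes.  At the time of the stop only the
left derivative exists on the edge. *)
Lemma crossing_subsolution s e x :
  eps * MP <= deltaP -> eps * MP * MQ <= deltaQ * mQ -> 0 <= deltaP ->
  0 <= deltaQ -> 0 < crossing_front s e x ->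
  e = inl tt \/ e = inr Omega1 \/ e = inr Omega5 ->
  exists wt q', [/\
    diff_quotient (fun s => crossing_front s e x) s r @[r --> s^'-] --> wt,
    lower_jet (crossing_front s e) x (crossing_slope s e x) q' &
    wt <= q' + f (crossing_front s e x)].
Proof.
move=> epsP epsQ dP0 dQ0 w0 e3; move: w0; have eps0 := eps_gt0.
have speedP z : - eps * p z <= deltaP.
  have /andP[h _] := fr_bound frP z; apply: le_trans epsP.
  by rewrite mulNr -mulrN ler_pM2l// lerNl.
rewrite /crossing_front /crossing_slope; case: e3 => [->|[->|->]] /= w0.
- have jP : lower_jet (fun y => P (y - stopped_shift s)) x (p (x - stopped_shift s))
      (deltaP - f (P (x - stopped_shift s))).
    have jP := fr_jet frP w0; apply: lower_jet_translate; exact: jP.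
  have [s0|s0] := ltP 0 s.
    exists 0, (deltaP - f (P (x - stopped_shift s))); split; rewrite ?subrK//.
    have := @static_quotient R (P x) s; apply: cvg_trans; apply: near_eq_cvg.
    near=> r; rewrite /diff_quotient /stopped_shift.
    have r0 : 0 < r by near: r; apply: nbhs_left_gt.
    have es : 0 <= eps * s by rewrite mulr_ge0// ltW.
    have er : 0 <= eps * r by rewrite mulr_ge0// ltW.
    by rewrite (min_r er) (min_r es) subr0.
  exists (- eps * p (x - eps * s)), (deltaP - f (P (x - stopped_shift s))).
  split; rewrite ?subrK//.
  have := is_derive_left (moving_front_derive x s); apply: cvg_trans.
  apply: near_eq_cvg; near=> r; rewrite /diff_quotient /stopped_shift.
  have rs : r < s by near: r; exact: nbhs_left_lt.
  have es : eps * s <= 0 by rewrite pmulr_rle0.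
  have er : eps * r <= 0 by rewrite pmulr_rle0// (le_trans (ltW rs)).
  by rewrite (min_l er) (min_l es).
- exists (q (- x + matched_shift s) * matched_shift1 s),
    (deltaQ - f (Q (- x + matched_shift s))); split.
  + have dx : is_derive s 1 (fun s => matched_shift s + - x) (matched_shift1 s).
      have := is_deriveD (matched_shift_derive s) (is_derive_cst (- x) s (1 : R)).
      by rewrite addr0.
    have -> : (fun s => Q (- x + matched_shift s)) =
        Q \o (fun s => matched_shift s + - x).
      by apply/funext => r /=; rewrite addrC.
    apply: is_derive_left; apply: is_derive1_comp dx.
    by rewrite addrC; exact: (fr_derive frQ).
  + by have jQ := fr_jet frQ w0; apply: lower_jet_reflect; exact: jQ.
  + have /andP[A1 A2] := fr_bound frQ (- x + matched_shift s).
    have /andP[C1 C2] := fr_bound frP (- (eps * s)).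
    have B1 := matched_shift_steep s; have m0 := fr_m frQ.
    have B0 : 0 < - q (matched_shift s).
      by rewrite oppr_gt0 (le_lt_trans B1)// oppr_lt0.
    rewrite subrK /matched_shift1.
    have -> : q (- x + matched_shift s) *
        ((q (matched_shift s))^-1 * (- eps * p (- (eps * s)))) =
        (- q (- x + matched_shift s)) * (eps * - p (- (eps * s))) /
        (- q (matched_shift s)).
      by field; rewrite lt_eqF// -oppr_gt0.
    rewrite ler_pdivrMr//.
    have h1 : (- q (- x + matched_shift s)) * (eps * - p (- (eps * s))) <=
        MQ * (eps * MP).
      by apply: ler_pM; rewrite ?ler_pM2l ?mulr_ge0 ?oppr_ge0 ?(ltW eps0)// lerNl.
    have h2 : deltaQ * mQ <= deltaQ * - q (matched_shift s).
      by rewrite ler_wpM2l// lerNr.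
    by apply: le_trans h1 _; apply: le_trans h2; rewrite mulrC.
- exists (- eps * p (x - eps * s)), (deltaP - f (P (x - eps * s))); split.
  + exact: is_derive_left (moving_front_derive x s).
  + by have jP := fr_jet frP w0; apply: lower_jet_translate; exact: jP.
  + by rewrite subrK.
Unshelve. all: by end_near. Qed.

(** The sum of the outward derivatives is |Q'| - 2 |P'| at the common value;
the squares of the two slopes are compared through the energy bounds of the
fronts. *)
Lemma crossing_kirchhoff s :
  (forall alpha, 0 <= alpha <= 1 ->
    4 * (F theta - F alpha) <= F bQ - F alpha - deltaQ) ->
  0 < Q (matched_shift s) -> 0 <= kirchhoff_sum G (crossing_front s) P1.
Proof.
move=> matching; rewrite matched_shiftK => al0; rewrite kirchhoff_sum_P1.
have px e (y : R) : edge_dom G e y ->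
    partial_x G (crossing_front s) e y = crossing_slope s e y.
  by move=> ye; have := partial_x_of ye (crossing_derive s).
rewrite !px; [|exact: edge_dom0..].
rewrite /crossing_slope /= !(oppr0, add0r, sub0r) stopped_slope.
have ep := fr_energy frP (ltW al0).
have eq : 2 * (F bQ - F (P (- (eps * s))) - deltaQ) <= q (matched_shift s) ^+ 2.
  have := fr_energy_low frQ (z := matched_shift s); rewrite matched_shiftK; apply.
  by rewrite !ltW.
have mt : 4 * (F theta - F (P (- (eps * s)))) <=
    F bQ - F (P (- (eps * s))) - deltaQ.
  by apply: matching; rewrite ltW//= (le_trans (fr_le frP _)).
have /andP[_ p0] := fr_bound frP (- (eps * s)).
have q0 : q (matched_shift s) <= 0.
  by rewrite (le_trans (matched_shift_steep s))// oppr_le0 ltW// (fr_m frQ).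
move: (q _) (p _) (F (P _)) q0 p0 ep eq mt => y z Fa y0 z0 ep eq mt.
suff : - (2 * z) <= - y by lra.
by rewrite -ler_sqr ?nnegrE; [rewrite !sqrrN; nra|lra|lra].
Qed.

End MovingFronts.

Lemma front_bound_gt0 (R : realType) (f F : R -> R) (b top delta : R)
    (S s W : R -> R) (T m M : R) :
  front f F b top delta S s W T m M -> 0 <= b -> 0 < M.
Proof.
move=> fr b0; have hT : S T <= b by rewrite (fr_zero fr).
have := fr_steep fr hT; have /andP[h1 _] := fr_bound fr T.
by have := fr_m fr; lra.
Qed.

(** The moving fronts start from a time at which they are positive only where
[u] exceeds beta, i.e. far away on the path 1; the time scale of the fronts is
unrelated to the speed of [u], whence the shift of time. *)
Theorem fronts_cross_junction (R : realType) (f F : R -> R)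
    (a bP theta deltaP : R) (P p WP : R -> R) (TP mP MP : R)
    (bQ beta deltaQ : R) (Q q WQ : R -> R) (TQ mQ MQ : R)
    (L : {posnum R}) (u : R -> graph_fun R unit 'I_5) :
  bistable f a -> 0 < deltaP -> 0 < deltaQ ->
  front f F bP theta deltaP P p WP TP mP MP ->
  front f F bQ beta deltaQ Q q WQ TQ mQ MQ ->
  a < bP -> bP < theta -> theta < bQ -> bQ < beta -> beta < 1 ->
  (forall alpha, 0 <= alpha <= 1 ->
    4 * (F theta - F alpha) <= F bQ - F alpha - deltaQ) ->
  TP <= L%:num ->
  entire_solution (two_vertex_graph L) f u ->
  (forall t e x, edge_dom (two_vertex_graph L) e x -> 0 < u t e x < 1) ->
  (exists t0 X, forall x, X <= x -> 0 <= x -> beta <= u t0 (inr Omega1) x) ->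
  forall X, exists t1, forall t x, t1 <= t -> 0 <= x <= X ->
    theta <= u t (inr Omega5) x.
Proof.
move=> hf deltaP0 deltaQ0 frP frQ abP bPtheta thetabQ bQbeta beta1 matching.
move=> TPL usol u01 [t0 [X uX]].
have [K K0 fK] := bistable_lipschitz hf.
have bP0 : 0 < bP by have /andP[a0 _] := bistable_a hf; exact: lt_trans abP.
have bQ0 : 0 < bQ by exact: lt_trans (lt_trans bP0 bPtheta) thetabQ.
have MP0 := front_bound_gt0 frP (ltW bP0); have MQ0 := front_bound_gt0 frQ (ltW bQ0).
have mQ0 := fr_m frQ.
have [eps [eps0 epsP epsQ]] : exists eps, [/\ 0 < eps, eps * MP <= deltaP &
    eps * MP * MQ <= deltaQ * mQ].
  exists (Num.min (deltaP / MP) (deltaQ * mQ / (MQ * MP))); split.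
  - by rewrite lt_min !divr_gt0 ?mulr_gt0.
  - by rewrite -ler_pdivlMr// ge_min lexx.
  - by rewrite -mulrA [MP * MQ]mulrC -ler_pdivlMr ?mulr_gt0// ge_min lexx orbT.
pose w := crossing_front L P Q WQ eps.
have b1 : beta <= 1 := ltW beta1.
have th1 : theta <= 1 by rewrite ltW// (lt_trans thetabQ)// (lt_trans bQbeta).
have w_far s : P (L%:num - stopped_shift eps s) <= 0.
  exact: (crossing_beyond _ frP).
pose X' := Num.max X 0.
have [y0 [y00 y0Q]] : exists y0, y0 < 0 /\ y0 < Q (X' + TQ).
  exists (Num.min 0 (Q (X' + TQ)) - 1).
  by split; rewrite ltrBlDr ?lt_min ?gt_min ltrDl ltr01 ?orbT.
have [s0 es0] : exists s0, - (eps * s0) = WP y0.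
  by exists (- WP y0 / eps); field; rewrite gt_eqF.
have Ps0 : P (- (eps * s0)) = y0.
  by rewrite es0 (fr_WK frP)// ltW// (lt_trans y00).
pose W t := w (t + (s0 - t0)).
have W_start e x : edge_dom (two_vertex_graph L) e x -> W t0 e x <= u t0 e x.
  move=> xe; have /andP[u0 _] := u01 t0 e x xe.
  have [W0|W0] := leP (W t0 e x) 0; first by apply: le_trans W0 (ltW _).
  move: W0 xe u0; rewrite /W addrC subrK /w /crossing_front.
  case: e => [i|j] W0 /= x0 u0.
    have /andP[x_ge0 _] := x0.
    have : P (x - stopped_shift eps s0) <= P (- stopped_shift eps s0).
      by apply: (fr_anti frP); rewrite lerDr.
    rewrite (stopped_value _ frP) Ps0 => h.
    by move: W0; rewrite ltNge (le_trans h (ltW y00)).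
  case: (outer_path_cases j) W0 u0 => [->|->|E] /=.
  - move=> Q0 _; have [Xx|xX] := leP X' x.
      apply: (le_trans (fr_le frQ _)); apply: uX => //.
      by apply: le_trans Xx; rewrite le_max lexx.
    have h : - x + matched_shift P WQ eps s0 < TQ.
      rewrite ltNge; apply/negP => /(fr_anti frQ); rewrite (fr_zero frQ).
      by rewrite leNgt Q0.
    have : Q (X' + TQ) <= Q (matched_shift P WQ eps s0).
      by apply: (fr_anti frQ); move: h xX; clear; lra.
    by rewrite (matched_shiftK _ frP frQ thetabQ) Ps0 leNgt y0Q.
  - move=> P0 _.
    have : P (x - eps * s0) <= P (- (eps * s0)) by apply: (fr_anti frP); rewrite lerDr.
    rewrite Ps0 => h.
    by move: P0; rewrite ltNge (le_trans h (ltW y00)).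
  - by move=> h _; exfalso; move: h; case: E => -> /=; rewrite ltNge w_far.
have below t e x : t0 <= t -> edge_dom (two_vertex_graph L) e x -> W t e x <= u t e x.
  move=> t0t; apply: (@subsolution_below R _ _ _ (two_vertex_graph L) f u K K0 fK
    usol u01 W t0 t); last by rewrite t0t lexx.
  - move=> e'; apply: continuous_subspaceT.
    exact: (crossing_continuous frP frQ thetabQ).
  - by move=> t' _; exact: crossing_single_valued frP frQ thetabQ _.
  - by move=> t' e' y _ _; exact: crossing_le1 frP frQ b1 th1 _ _ _.
  - exact: W_start.
  - move=> t' e' y _ yi uW.
    have /andP[u0 _] := u01 t' e' y (edge_interior_dom yi).
    have W0 : 0 < w (t' + (s0 - t0)) e' y by exact: lt_trans uW.
    have e'3 : e' = inl tt \/ e' = inr Omega1 \/ e' = inr Omega5.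
      move: W0; rewrite /w /crossing_front; case: e' {yi uW u0} => [[]|j].
        by left.
      have wf := w_far (t' + (s0 - t0)).
      case: (outer_path_cases j) => [->|->|E] W0; [by right; left|by right; right|].
      by exfalso; move: W0; case: E => -> /=; rewrite ltNge wf.
    have [wt [q' [dq jq wq]]] := crossing_subsolution frP frQ thetabQ eps0 epsP epsQ
      (ltW deltaP0) (ltW deltaQ0) W0 e'3.
    exists wt, (crossing_slope P p q WQ eps (t' + (s0 - t0)) e' y), q'; split => //.
    exact: (left_quotient_translate (g := fun s => w s e' y)).
  - move=> t' _.
    exact: graph_derivable_of (crossing_derive L eps frP frQ _).
  - move=> t' P' _; have [->|->] := vertex_cases P'.
      move=> /negative_at_P1; rewrite /W /w /=.
      have /andP[u0 _] := u01 t' (inr Omega1) 0 (lexx 0).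
      rewrite oppr0 add0r => h; apply: (crossing_kirchhoff L frP frQ) => //.
      by move: u0 h; clear; lra.
    move=> /negative_at_P2; rewrite /W /w /=.
    have /andP[u0 _] := u01 t' (inr Omega2) 0 (lexx 0).
    by have := w_far (t' + (s0 - t0)); move: u0; clear; lra.
move=> Y; exists (Num.max t0 (t0 - s0 + Y / eps)) => t x.
rewrite ge_max => /andP[t0t tY] /andP[x0 xY].
have := below t (inr Omega5) x t0t x0; rewrite /W /w /= (fr_plateau frP)//.
have : Y <= eps * (t + (s0 - t0)).
  by rewrite mulrC -ler_pdivrMr//; move: tY; clear; lra.
by move: xY; clear; lra.
Qed.

(** * Growth towards one on an outer path *)

Section Growth.
Variables (R : realType) (f : R -> R) (a : R).
Variables (V I J : finType) (G : metric_graph R V I J).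
Variable (u : R -> graph_fun R I J).

(** A finite part of an outer path, on which [growth] applies the maximum
principle. *)
Definition single_edge (l : {posnum R}) : metric_graph R bool unit void :=
  MetricGraph (fun=> l) (fun=> false) (fun=> true) (of_void bool).

Lemma derivable_on_sub (D D' : set R) (g : R -> R) x : D' `<=` D ->
  derivable_on D g x -> derivable_on D' g x.
Proof.
move=> DD /cvgrPdist_lt dg; apply/cvg_ex; exists (derive_on D g x).
apply/cvgrPdist_lt => e e0; have := dg e e0.
by rewrite !near_withinE; apply: filterS => y H yx yD; apply: H => //; exact: DD.
Qed.

(** Comparison on [0, 2 X] with theta + r (s - T) k x (2 X - x), which equals
theta at both ends, and reaches beta at the midpoint X after the time 1 / r.
It is a subsolution when r and 1 / X are small compared with the minimum of f
on [theta, beta]. *)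
Lemma growth (theta beta : R) (j : J) : bistable f a ->
  entire_solution G f u ->
  (forall t e x, edge_dom G e x -> 0 < u t e x < 1) ->
  a < theta -> theta < beta -> beta < 1 ->
  (forall X, exists t1, forall t x, t1 <= t -> 0 <= x <= X ->
    theta <= u t (inr j) x) ->
  exists X0, forall X, X0 <= X -> exists t2, forall t, t2 <= t ->
    beta <= u t (inr j) X.
Proof.
move=> hf usol u01 ath thb b1 uth.
have /andP[a0 a1] := bistable_a hf.
have [K K0 fK] := bistable_lipschitz hf.
have [c] := @EVT_min R f theta beta (ltW thb)
  (continuous_subspaceT (bistable_continuous hf)).
rewrite in_itv /= => /andP[thc cb] cmin.
pose r := f c / 2.
have r0 : 0 < r.
  rewrite divr_gt0//; apply: (bistable_pos hf); apply/andP; split; lra.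
have fr y : theta <= y <= beta -> 2 * r <= f y.
  by move=> yi; have := cmin y; rewrite in_itv => /(_ yi); rewrite /r; lra.
clearbody r.
exists (1 + 2 / r) => X X0X.
have r20 : 0 < 2 / r by rewrite divr_gt0.
have X1 : 1 <= X by lra.
have X0 : 0 < X by lra.
have rX : 2 / X ^+ 2 <= r.
  rewrite ler_pdivrMr ?exprn_gt0//.
  have h1 : 2 <= r * X by rewrite mulrC -ler_pdivrMr//; lra.
  have h2 : r * X <= r * X ^+ 2 by rewrite ler_pM2l// expr2 ler_peMl// ltW.
  by lra.
have [t1 ut1] := uth (2 * X).
have l0 : 0 < 2 * X by rewrite mulr_gt0.
exists (t1 + r^-1) => t t1t.
pose T := t - r^-1.
have t1T : t1 <= T by rewrite /T; lra.
have ri0 : 0 < r^-1 by rewrite invr_gt0.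
pose G1 := single_edge (PosNum l0).
pose k := (beta - theta) / X ^+ 2.
have k0 : 0 <= k by rewrite divr_ge0 ?exprn_ge0; lra.
pose w s x := theta + r * (s - T) * (k * (x * (2 * X - x))).
have hump x : 0 <= x <= 2 * X -> 0 <= k * (x * (2 * X - x)) <= beta - theta.
  move=> /andP[h1 h2]; apply/andP; split.
    by rewrite mulr_ge0// mulr_ge0// subr_ge0.
  have -> : beta - theta = k * X ^+ 2 by rewrite /k; field; rewrite gt_eqF.
  apply: ler_wpM2l => //; rewrite -subr_ge0.
  have -> : X ^+ 2 - x * (2 * X - x) = (X - x) ^+ 2 by ring.
  exact: sqr_ge0.
have ramp s : T <= s <= t -> 0 <= r * (s - T) <= 1.
  move=> /andP[h1 h2]; apply/andP; split.
    by rewrite mulr_ge0 ?(ltW r0)// subr_ge0.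
  by rewrite mulrC -ler_pdivlMr// div1r; rewrite /T; lra.
have dw s (x : R) : is_derive x 1 (w s) (r * (s - T) * (k * (2 * X - 2 * x))).
  by apply: is_derive_eq; rewrite /GRing.scale /=; ring.
have Z : 0 <= u t (inr j) X - w t X.
  apply: (@maximum_principle R bool unit void G1
    (fun s _ x => u s (inr j) x - w s x) T t K 2 K0 _ _ _ _ _ _ _ t (inl tt) X).
  - have cu : {within `[T, t] `*` edge_dom G1 (inl tt),
        continuous (fun p : R * R => u p.1 (inr j) p.2)}.
      apply: continuous_subspaceW (@solution_continuous _ _ _ _ _ _ _ usol T t (inr j)).
      by move=> q [q1 /= /andP[q2 _]]; split.
    move=> [[]|[]] p; apply: cvgB.
      exact: cu.
    apply: (@continuous_subspaceT _ _ _ (fun q : R * R => w q.1 q.2)) => q.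
    rewrite /w.
    apply: cvgD; first exact: cvg_cst.
    apply: cvgM.
      apply: cvgM; first exact: cvg_cst.
      by apply: cvgB; [exact: cvg_fst|exact: cvg_cst].
    apply: cvgM; first exact: cvg_cst.
    apply: cvgM; first exact: cvg_snd.
    by apply: cvgB; [exact: cvg_cst|exact: cvg_snd].
  - move=> s _; exists (fun b : bool => if b then u s (inr j) (2 * X) - w s (2 * X)
      else u s (inr j) 0 - w s 0).
    by split => // -[].
  - move=> s [[]|[]] x si xe /=; have /andP[h1 h2] := hump _ xe.
    have /andP[h3 h4] := ramp _ si.
    have x0 : 0 <= x by case/andP: xe.
    have /andP[u0 _] := u01 s (inr j) x x0.
    have : w s x <= 1.
      have := ler_piMl h1 h4; rewrite /w; lra.
    by lra.
  - move=> [[]|[]] x xe /=; rewrite subr_ge0 /w subrr mulr0 mul0r addr0.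
    by apply: ut1.
  - move=> s [[]|[]] x si xi /= zneg.
    have xi' : 0 < x by case/andP: xi.
    have xe : 0 <= x <= 2 * X by case/andP: xi => /ltW -> /ltW ->.
    have [ut [p [q [dut ju _ ute]]]] := solution_jet usol s (x := x) (e := inr j) xi'.
    have /andP[h1 h2] := hump _ xe.
    have si' : T <= s <= t by case/andP: si => /ltW -> ->.
    have /andP[h3 h4] := ramp _ si'.
    exists (ut - r * (k * (x * (2 * X - x)))),
      (p + - (r * (s - T) * (k * (2 * X - 2 * x)))), (q + - (- (2 * (r * (s - T) * k)))).
    have ws : theta <= w s x <= beta.
      rewrite /w lerDl mulr_ge0//=.
      by have := ler_piMl h1 h4; lra.
    split.
    + rewrite (diff_quotientD (fun s => u s (inr j) x) (\- (fun s => w s x))).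
      rewrite diff_quotientN; apply: (cvgB (is_derive_left dut)).
      apply: is_derive_left.
      by apply: is_derive_eq; rewrite /GRing.scale /=; ring.
    + apply: upper_jetD => //; apply: upper_jetN.
      apply: (@lower_jet_taylor _ (w s) (fun x => r * (s - T) * (k * (2 * X - 2 * x)))).
        by near=> y; exact: dw.
      by apply: is_derive_eq; rewrite /GRing.scale /=; ring.
    + have fw := fr _ ws.
      have /andP[u0 u1] := u01 s (inr j) x (ltW xi').
      have : `|f (u s (inr j) x) - f (w s x)| <= K * `|u s (inr j) x - w s x|.
        by apply: fK; apply/andP; split; lra.
      rewrite (ltr0_norm zneg) ler_norml => /andP[g1 g2].
      have g3 : r * (k * (x * (2 * X - x))) <= r.
        rewrite ger_pMr//; lra.
      have g4 : 2 * (r * (s - T) * k) <= r.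
        apply: le_trans rX; rewrite ler_pM2l//.
        apply: (@le_trans _ _ k); first exact: ler_piMl.
        by rewrite /k ler_pdivrMr ?exprn_gt0// mulVf ?gt_eqF ?exprn_gt0//; lra.
      by lra.
  - move=> s [[]|[]] x si xe; have xe' : edge_dom G (inr j) x by case/andP: xe.
    have h1 : derivable_on (edge_dom G1 (inl tt)) (u s (inr j)) x.
      apply: (@derivable_on_sub (edge_dom G (inr j))); first by move=> y /= /andP[].
      exact: (sol_derivable_x usol).
    have [h2 _] := derive_on_is_derive xe (dw s x).
    by have [] := derive_onB xe h1 h2.
  - move=> s P si [hs ht _]; exfalso.
    have sT : t1 <= s by case/andP: si => /ltW h _; exact: le_trans h.
    case: P hs ht => hs ht.
      have := ht tt erefl; rewrite /w /= subrr !mulr0 addr0 ltNge subr_ge0.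
      by rewrite ut1// lexx andbT ltW.
    have := hs tt erefl; rewrite /w /= mul0r !mulr0 addr0 ltNge subr_ge0.
    by rewrite ut1// lexx ltW.
  - by rewrite lexx andbT /T lerBlDr lerDl ltW.
  - by rewrite /= (ltW X0) /=; lra.
have tT : t - T = r^-1 by rewrite /T; ring.
move: Z; rewrite /w tT divff ?gt_eqF// mul1r.
have -> : k * (X * (2 * X - X)) = beta - theta by rewrite /k; field; rewrite gt_eqF.
by lra.
Unshelve. all: by end_near. Qed.

End Growth.

(** * The front-like solution *)

Section InitialData.
Variables (R : realType) (V I J : finType) (G : metric_graph R V I J).
Variables (f phi : R -> R) (a c : R) (i : J) (u : R -> graph_fun R I J).
Hypothesis htw : traveling_wave f a phi c.
Hypothesis hu : front_like_solution G f phi c i u.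

(** Each of the two suprema is nonnegative, so both tend to 0. *)
Lemma front_like_initial (s : R) : 0 < s -> exists t0,
  (forall x, 0 <= x -> `|u t0 (inr i) x - phi (- x - c * t0)| <= s) /\
  (forall e x, e != inr i -> edge_dom G e x -> u t0 e x <= s).
Proof.
move=> s0; have /cvgrPdist_lt/(_ s s0)[t1 [_ H]] := front_limit hu.
pose t0 := t1 - 1; exists t0.
have := H t0; rewrite /t0 gtrDl ltrN10 => /(_ isT); rewrite -/t0 sub0r normrN.
set S1 := sup _; set S2 := sup _ => S12.
have ub1 x : 0 <= x -> `|u t0 (inr i) x - phi (- x - c * t0)| <= S1.
  move=> x0; apply: ub_le_sup; last by exists x.
  exists 1 => _ [y /= y0 <-].
  have /andP[h1 h2] := front_range hu t0 (e := inr i) y0.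
  have /andP[h3 h4] := tw_range htw (- y - c * t0).
  by rewrite ler_norml; apply/andP; split; lra.
have ub2 e x : e != inr i -> edge_dom G e x -> `|u t0 e x| <= S2.
  move=> ei ex; apply: ub_le_sup; last by exists e, x.
  exists 1 => _ [e' [y [_ y0 ->]]].
  have /andP[h1 h2] := front_range hu t0 y0.
  by rewrite ler_norml; apply/andP; split; lra.
have S10 : 0 <= S1 by apply: le_trans (ub1 0 (lexx 0)).
have S12s : S1 + S2 < s by apply: le_lt_trans S12; exact: ler_norm.
have [[e [x [ei ex]]]|none] := pselect (exists e x, e != inr i /\ edge_dom G e x).
  have S20 : 0 <= S2 by apply: le_trans (ub2 e x ei ex).
  split=> [y y0|e' y e'i ye]; first by have := ub1 y y0; lra.
  have := ub2 e' y e'i ye; have := ler_norm (u t0 e' y); lra.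
have S2E : S2 = 0.
  rewrite /S2 -[RHS](@sup0 R); congr sup; apply/seteqP; split => // y [e [x [ei ex _]]].
  by case: none; exists e, x.
split=> [y y0|e' y e'i ye]; first by have := ub1 y y0; lra.
by case: none; exists e', y.
Qed.

(** Far out on the path the solution is close to the part of the travelling
wave that tends to 1. *)
Lemma front_like_invasion beta : beta < 1 ->
  exists t0 X, forall x, X <= x -> 0 <= x -> beta <= u t0 (inr i) x.
Proof.
move=> b1; pose d := (1 - beta) / 2; have d0 : 0 < d by rewrite /d; lra.
have [t0 [ut0 _]] := front_like_initial d0.
have /cvgrPdist_lt/(_ d d0)[z0 [_ H]] := tw_left htw.
exists t0, (1 - z0 - c * t0) => x Xx x0.
have /H : - x - c * t0 < z0 by lra.
have := ut0 x x0; rewrite /= ler_norml ltr_norml /d => /andP[h1 h2] /andP[h3 h4].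
by lra.
Qed.

End InitialData.

Theorem proposition2p23 (R : realType) (f : R -> R) (a : R) (phi : R -> R)
    (c : R) (hf : bistable f a) (htw : traveling_wave f a phi c)
    (hlo : 0 < primitive f 1 + (2 ^+ 2 - 1) * primitive f a)
    (hhi : primitive f 1 + (3 ^+ 2 - 1) * primitive f a < 0) :
  exists L0 : R, forall L : {posnum R}, L0 < L%:num ->
    forall (u : R -> graph_fun R unit 'I_5) (v : graph_fun R unit 'I_5),
    front_like_solution (two_vertex_graph L) f phi c Omega1 u ->
    limit_profile (two_vertex_graph L) u v ->
    [/\ propagation_index v Omega5 1,
        propagation_index v Omega2 0,
        propagation_index v Omega3 0 &
        propagation_index v Omega4 0].
Proof.
have /andP[a0 a1] := bistable_a hf.
have cf := bistable_continuous hf.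
have [F' dF'] := antiderivative cf.
pose F x := F' x - F' 0.
have dF (x : R) : is_derive x 1 F (f x).
  by have ? := dF' x; apply: is_derive_eq; rewrite subr0.
have F0 : F 0 = 0 by rewrite /F subrr.
have prim s : 0 < s -> primitive f s = F s by exact: primitiveE.
have mass : 0 < F 1 by rewrite -prim//; exact: (bistable_mass hf).
rewrite !prim// in hlo hhi.
have lo : 0 < F 1 + 3 * F a by move: hlo; rewrite expr2; lra.
have hi : F 1 + 8 * F a < 0 by move: hhi; rewrite expr2; lra.
have [LB blockP] := blocking hf dF F0 hi.
have [bP [th [dP [P [p [WP [TP [mP [MP [bQ [be [dQ [Q [q [WQ [TQ [mQ [MQ
  [[dP0 dQ0] frP frQ [abP bPth thbQ bQbe be1] matching]]]]]]]]]]]]]]]]]]] :=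
  fronts_exist hf dF F0 mass lo.
exists (Num.max LB TP) => L; rewrite gt_max => /andP[LBL TPL] u v hu huv.
have usol := front_solution hu; have u01 := front_range hu.
have blocked := blockP L LBL u usol u01.
have {}blocked := blocked (fun s s0 =>
  let: ex_intro t0 (conj _ H) := front_like_initial htw hu s0 in ex_intro _ t0 H).
have v0 j x : 0 <= x -> 0 <= v (inr j) x.
  move=> x0; have vx := huv (inr j) x x0.
  by apply: (cvgr_to_ge vx); near=> t; have /andP[/ltW] := u01 t (inr j) x x0.
have v1 j x : 0 <= x -> v (inr j) x <= 1.
  move=> x0; have vx := huv (inr j) x x0.
  by apply: (cvgr_to_le vx); near=> t; have /andP[_ /ltW] := u01 t (inr j) x x0.
have vblocked j : j \in [:: Omega2; Omega3; Omega4] -> propagation_index v j 0.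
  move=> jin; apply/cvgrPdist_le => d d0.
  have [t0 [X H]] := blocked d d0.
  have vd x : 0 <= x -> X <= x -> v (inr j) x <= d.
    move=> x0 Xx; have vx := huv (inr j) x x0.
    apply: (cvgr_to_le vx).
    by apply: filterS (nbhs_pinfty_ge (num_real t0)) => t t0t; exact: H.
  near=> x.
  have x0 : 0 <= x by near: x; exact: nbhs_pinfty_ge.
  rewrite sub0r normrN ger0_norm; last exact: v0.
  by apply: vd => //; near: x; apply: nbhs_pinfty_ge; exact: num_real.
split; [|exact: vblocked..].
have := fronts_cross_junction hf dP0 dQ0 frP frQ abP bPth thbQ bQbe be1 matching
  (ltW TPL) usol u01 (front_like_invasion htw hu be1) => cross.
apply/cvgrPdist_le => d d0.
(* A value above th which is within d of 1. *)
pose b := Num.max (1 - d) ((th + 1) / 2).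
have b1 : b < 1 by rewrite gt_max; apply/andP; split; lra.
have thb : th < b by rewrite lt_max; apply/orP; right; lra.
have db : 1 - d <= b by rewrite le_max lexx.
have ath : a < th by lra.
have [X0 H] := growth hf usol u01 ath thb b1 cross.
have vb x : 0 <= x -> X0 <= x -> b <= v (inr Omega5) x.
  move=> x0 Xx; have vx := huv (inr Omega5) x x0; have [t2 Ht2] := H x Xx.
  apply: (cvgr_to_ge vx).
  by apply: filterS (nbhs_pinfty_ge (num_real t2)) => t; exact: Ht2.
near=> x.
have x0 : 0 <= x by near: x; exact: nbhs_pinfty_ge.
have : b <= v (inr Omega5) x.
  by apply: vb => //; near: x; apply: nbhs_pinfty_ge; exact: num_real.
have := v1 Omega5 x x0 => h1 h2.
by rewrite ger0_norm; lra.
Unshelve. all: by end_near. Qed.
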